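(* Suppose that for each $i\in\mathcal{J}$ there exists $A_i\subset\mathcal{J}$ such that $X_i$ and $X_{A_i^c}$ are independent. With $Y_i=\sum_{j\in A_i}X_j$ and $\hat K(t)$ as in the context, define $$r_1 = E\Big|\sum_{i \in \mathcal{J}} (X_i Y_i - E[X_i Y_i])\Big|,\quad r_2 = \sum_{i \in \mathcal{J}} E\big[|X_i Y_i| I(|Y_i| > 1)\big],$$ $$r_3 = \sum_{i \in \mathcal{J}} E\big[|X_i|(Y_i^2 \wedge 1)\big],\quad r_4 = \sum_{i \in \mathcal{J}} E\big[|WX_i|(Y_i^2 \wedge 1)\big],$$ $$r_5 = \int_{|t| \leq 1} \mathrm{Var}(\hat{K}(t)) \, dt,\quad r_6 = \Big(\int_{|t| \leq 1} |t|\, \mathrm{Var}(\hat{K}(t)) \, dt\Big)^{1/2}.$$ Then $$\sup_{z\in\mathbb{R}} |F(z) - \Phi(z)| \leq r_1 + 4r_2 + 8r_3 + r_4 + 4.5r_5 + 1.5r_6.$$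
   Context: $\mathcal{J}$ is a finite index set and $\{X_i, i\in\mathcal{J}\}$ is a family of real random variables on a common probability space with zero means and finite variances. $W=\sum_{i\in\mathcal{J}}X_i$, and it is assumed that $\mathrm{Var}(W)=1$. $F$ is the distribution function of $W$ and $\Phi$ is the standard normal distribution function. For $A\subset\mathcal{J}$, $X_A=\{X_i, i\in A\}$ and $A^c=\mathcal{J}\setminus A$. $a\wedge b=\min(a,b)$; $I(\cdot)$ is the indicator. For $t\in\mathbb{R}$, $$\hat{K}_i(t) = X_i\{I(-Y_i \leq t < 0) - I(0 \leq t \leq -Y_i)\},\qquad \hat{K}(t)=\sum_{i\in\mathcal{J}}\hat K_i(t).$$ *)

(* Defs.v *)
From HB Require Import structures.
From mathcomp Require Import all_boot all_order all_algebra.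
From mathcomp Require Import all_classical all_reals all_analysis.
Set Implicit Arguments.
Unset Strict Implicit.
Unset Printing Implicit Defensive.
Import Order.TTheory GRing.Theory Num.Theory.
Import numFieldNormedType.Exports.
Local Open Scope classical_set_scope.
Local Open Scope ring_scope.

Section independence.
Context d (T : measurableType d) (R : realType) (P : probability T R).

Definition independent_systems (G H : set (set T)) : Prop :=
  forall B C, G B -> H C -> P (B `&` C) = (P B * P C)%E.

Context (J : finType) (X : J -> {RV P >-> R}).

(* For B empty this is the trivial sigma-algebra. *)
Definition sigma_family (B : {set J}) : set (set T) :=
  <<s \bigcup_(j in [set` B]) preimage_set_system setT (X j) measurable >>.

(* The preimages of Borel sets by Z already form the sigma-algebra of Z. *)
Definition independent_of_family (Z : {RV P >-> R}) (B : {set J}) : Prop :=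
  independent_systems (preimage_set_system setT Z measurable) (sigma_family B).

End independence.

Section total_sum.
Context d (T : measurableType d) (R : realType) (P : probability T R).
Context (J : finType) (X : J -> {RV P >-> R}).

Definition total_sum (w : T) : R := \sum_(i : J) X i w.

Let measurable_total_sum : measurable_fun setT total_sum.
Proof. by apply: measurable_sum => i; exact: measurable_funP. Qed.

HB.instance Definition _ :=
  isMeasurableFun.Build _ _ T R total_sum measurable_total_sum.

Definition cdf_total_sum (z : R) : \bar R :=
  cdf (total_sum : {RV P >-> R}) z.

End total_sum.

Definition std_normal_cdf (R : realType) (z : R) : \bar R :=
  normal_prob (0 : R) 1 `]-oo, z].

Section stein.
Context d (T : measurableType d) (R : realType) (P : probability T R).
Context (J : finType) (X : J -> {RV P >-> R}) (A : J -> {set J}).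

Local Notation W := (total_sum X).

Definition neighborhood_sum (i : J) (w : T) : R := \sum_(j in A i) X j w.

Local Notation Y := neighborhood_sum.

Definition Khat_summand (i : J) (t : R) (w : T) : R :=
  X i w * ((- Y i w <= t < 0)%R%:R - (0 <= t <= - Y i w)%R%:R).

Definition Khat (t : R) (w : T) : R := \sum_(i : J) Khat_summand i t w.

Local Open Scope ereal_scope.

Definition r1 : \bar R :=
  'E_P[fun w => `|\sum_(i : J)
     (X i w * Y i w - fine 'E_P[fun v => X i v * Y i v])|%R].

Definition r2 : \bar R :=
  \sum_(i : J) 'E_P[fun w => (`|X i w * Y i w| * (1 < `|Y i w|)%R%:R)%R].

Definition r3 : \bar R :=
  \sum_(i : J) 'E_P[fun w => (`|X i w| * Num.min (Y i w ^+ 2) 1)%R].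

Definition r4 : \bar R :=
  \sum_(i : J) 'E_P[fun w => (`|W w * X i w| * Num.min (Y i w ^+ 2) 1)%R].

Definition r5 : \bar R :=
  \int[lebesgue_measure]_(t in [set t : R | (`|t| <= 1)%R]) 'V_P[Khat t].

Definition r6 : \bar R :=
  (\int[lebesgue_measure]_(t in [set t : R | (`|t| <= 1)%R])
     (`|t|%:E * 'V_P[Khat t])) `^ 2^-1.

End stein.

(* Main.v *)
Require Import Defs.
From HB Require Import structures.
From mathcomp Require Import all_boot all_order all_algebra.
From mathcomp Require Import all_classical all_reals all_analysis.
From mathcomp Require Import measurable_realfun.
From mathcomp Require Import ring lra.
Set Implicit Arguments.
Unset Strict Implicit.
Unset Printing Implicit Defensive.
Import Order.TTheory GRing.Theory Num.Theory.
Import numFieldNormedType.Exports.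
Local Open Scope classical_set_scope.
Local Open Scope ring_scope.

(** Stein's method with a random kernel.  Write [W] for the sum of the [X i],
    [Y i] for the sum over the neighbourhood [A i], and [K t] for the mean of
    [Khat t].  As [X i] is centred and independent of [W - Y i],
    [E (W f(W)) = sum_i E (X i (f(W) - f(W - Y i)))], and the fundamental
    theorem of calculus turns the right-hand side into
    [E (int f'(W + t) Khat t dt)] (lemmas [stein_identity] and
    [Rintegral_kern]).  Cutting the integral at [|t| <= 1] costs at most [r2]
    for every [f] with [|f'| <= 1] ([window_derivative]).  The same
    computation for [f = id] gives [sum_i E (X i * Y i) = E W^2 = 1]
    ([sum_mulrXY]), which is the total mass of [K].

    Concentration.  Take for [f'] a trapezoid equal to 1 on [[a, b]], with
    ramps of length [l], and choose [f] so that [|f| <= (b - a) / 2 + l]: then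
    [E (W f(W)) <= (b - a) / 2 + l], whereas [E (int f'(W + t) Khat t dt)] is
    close to [E f'(W)], which is at least [P (a <= W <= b)].  The fluctuation
    [Khat - K] is absorbed by Young's inequality and costs a multiple of [r5].
    Moving [W + t] back to [W] costs [r3] times the largest probability, per
    unit length, of an interval of length [l]; with [b - a = l] and [l] at
    least [r3] this closes up into a bound on that probability
    ([concentration_small], then [concentration]).

    Normal approximation.  Let [h] be the indicator of [w <= z] smoothed on an
    interval of length [L], and [f] the bounded solution of Stein's equation
    [f' w - w f w = h w - N h], where [N h] is the Gaussian mean.  The Mills
    ratio gives [|f'| <= 1] ([stein_deriv_le1]).  Then [E h(W) - N h] is, up to
    [r1 + 2 r2], the integral of [E ((f'(W) - f'(W + t)) Khat t)] over
    [|t| <= 1].  By Stein's equation, [f'(W) - f'(W + t)] is [h(W) - h(W + t)]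
    up to [(|W| + 6) |t|], which yields [r3] and [r4].  The difference
    [h(W) - h(W + t)] is a ramp increment, nonzero only when [W] is near [z]:
    concentration bounds its mean by [|t| dlt / L], where [dlt] bounds the
    probability of intervals of length [L].  Paired with [K] it contributes
    [r3] again; paired with [Khat - K] it contributes [r6], by Young's
    inequality with weight [|t|] ([ramp_part_bound]).

    The errors of concentration suggest [L] of the order of
    [r2 + r3 + r5]; with [L] twice the error term of [concentration], the
    ratio [dlt / L] is [9 / 8], and the last contribution is exactly
    [3 / 2 * r6].  Undoing the smoothing costs [L / 4]
    ([kolmogorov_bound_slack]). *)

(** * Integrals of real-valued functions *)

Section integration_tools.
Context d (T : measurableType d) (R : realType).
Implicit Types (mu : {measure set T -> \bar R}) (D : set T) (f g : T -> R).

Lemma measurable_natr_bool (b : T -> bool) :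
  measurable_fun setT b -> measurable_fun setT (fun x => (b x)%:R : R).
Proof.
move=> mb; have := @measurable_fun_ifT _ _ T R (cst 1) (cst 0) b mb.
move/(_ (@measurable_cst _ _ _ _ _ _) (@measurable_cst _ _ _ _ _ _)).
by apply: eq_measurable_fun => x _; case: (b x).
Qed.

Lemma integrable_addr mu D f g : measurable D ->
  mu.-integrable D (EFin \o f) -> mu.-integrable D (EFin \o g) ->
  mu.-integrable D (EFin \o (fun x => f x + g x)).
Proof. by move=> mD intf intg; exact: (integrableD mD intf intg). Qed.

Lemma integrable_subr mu D f g : measurable D ->
  mu.-integrable D (EFin \o f) -> mu.-integrable D (EFin \o g) ->
  mu.-integrable D (EFin \o (fun x => f x - g x)).
Proof. by move=> mD intf intg; exact: (integrableB mD intf intg). Qed.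

Lemma integrable_mulrl mu D k f : measurable D ->
  mu.-integrable D (EFin \o f) ->
  mu.-integrable D (EFin \o (fun x => k * f x)).
Proof. by move=> mD intf; exact: (integrableZl mD k intf). Qed.

Lemma integrable_sumr mu D (I : finType) (F : I -> T -> R) : measurable D ->
  (forall i, mu.-integrable D (EFin \o F i)) ->
  mu.-integrable D (EFin \o (fun x => \sum_i F i x)).
Proof.
move=> mD intF.
have := integrable_sum mD (index_enum I) (fun i (_ : xpredT i) => intF i).
by apply: eq_integrable => // x _ /=; rewrite sumEFin.
Qed.

Lemma Rintegral_sum mu D (I : finType) (F : I -> T -> R) : measurable D ->
  (forall i, mu.-integrable D (EFin \o F i)) ->
  \int[mu]_(x in D) (\sum_i F i x) = \sum_i \int[mu]_(x in D) F i x.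
Proof.
move=> mD intF; rewrite /Rintegral.
under eq_integral do rewrite -sumEFin.
rewrite (integral_sum mD intF) -sum_fine//.
by move=> i _; exact: integrable_fin_num.
Qed.

Lemma le_integrabler mu D f g : measurable D -> measurable_fun D f ->
  (forall x, D x -> `|f x| <= g x) ->
  mu.-integrable D (EFin \o g) -> mu.-integrable D (EFin \o f).
Proof.
move=> mD mf fg; apply: le_integrable => //; first exact/measurable_EFinP.
by move=> x Dx /=; rewrite lee_fin (le_trans (fg x Dx))// ler_norm.
Qed.

Lemma integrable_normr mu D f : measurable D ->
  mu.-integrable D (EFin \o f) ->
  mu.-integrable D (EFin \o (fun x => `|f x|)).
Proof.
by move=> mD intf; exact: (integrable_norm intf).
Qed.

Lemma integrable_measurable mu D f :
  mu.-integrable D (EFin \o f) -> measurable_fun D f.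
Proof. by move/measurable_int/measurable_EFinP. Qed.

Lemma bounded_integrabler mu D f (M : R) : measurable D -> (mu D < +oo)%E ->
  measurable_fun D f -> (forall x, D x -> `|f x| <= M) ->
  mu.-integrable D (EFin \o f).
Proof.
move=> mD Dfin mf fM; apply: measurable_bounded_integrable => //.
exists M; split; first by rewrite num_real.
by move=> r Mr x Dx; rewrite /= (le_trans (fM x Dx))// ltW.
Qed.

Lemma le_integrable_mul_bounded mu D f g (M : R) : measurable D ->
  measurable_fun D f -> (forall x, D x -> `|f x| <= M) ->
  mu.-integrable D (EFin \o g) ->
  mu.-integrable D (EFin \o (fun x => f x * g x)).
Proof.
move=> mD mf fM intg.
apply: (@le_integrabler _ _ _ (fun x => M * `|g x|)) => //.
- by apply: measurable_funM => //; exact: integrable_measurable intg.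
- by move=> x Dx; rewrite normrM ler_wpM2r// fM.
- exact/integrable_mulrl/integrable_normr.
Qed.

Lemma Rintegral_EFin mu D f : measurable D ->
  mu.-integrable D (EFin \o f) ->
  (\int[mu]_(x in D) (f x)%:E)%E = (\int[mu]_(x in D) f x)%:E.
Proof. by move=> mD intf; rewrite fineK//; exact: integrable_fin_num. Qed.

Lemma le_norm_Rintegral mu D f g : measurable D -> measurable_fun D f ->
  (forall x, D x -> `|f x| <= g x) ->
  mu.-integrable D (EFin \o g) ->
  `|\int[mu]_(x in D) f x| <= \int[mu]_(x in D) g x.
Proof.
move=> mD mf fg intg; have intf := le_integrabler mD mf fg intg.
by rewrite (le_trans (le_normr_Rintegral mD intf))// le_Rintegral//;
  exact: integrable_normr.
Qed.

End integration_tools.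

Section fubini_dominated.
Context d (T : measurableType d) (R : realType) (P : probability T R).
Local Notation mu := (@lebesgue_measure R).

(** The form of Fubini's theorem used throughout: the time variable ranges over
    a set of finite measure and the integrand is dominated by an integrable
    function of the random outcome alone. *)
Lemma Fubini_dominated (D : set R) (G : T * R -> R) (S : T -> R) :
  measurable D -> (mu D < +oo)%E -> measurable_fun setT G ->
  P.-integrable setT (EFin \o S) ->
  (forall w t, D t -> `|G (w, t)| <= S w) ->
  [/\ \int[P]_w \int[mu]_(t in D) G (w, t) =
      \int[mu]_(t in D) \int[P]_w G (w, t),
      mu.-integrable D (EFin \o (fun t => \int[P]_w G (w, t))) &
      P.-integrable setT (EFin \o (fun w => \int[mu]_(t in D) G (w, t)))].
Proof.
move=> mD Dfin mG intS GS.
have mG1 w : measurable_fun setT (fun t => G (w, t)).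
  exact: measurable_fun_pair2.
have mG2 t : measurable_fun setT (fun w => G (w, t)).
  exact: measurable_fun_pair1.
have intG1 w : mu.-integrable D (EFin \o (fun t => G (w, t))).
  apply: (@bounded_integrabler _ _ _ _ _ _ (S w)) => //.
    exact: (measurable_funTS (mG1 w)).
  by move=> t; exact: GS.
have intG2 t : D t -> P.-integrable setT (EFin \o (fun w => G (w, t))).
  by move=> Dt; apply: le_integrabler intS => // w _; exact: GS.
pose F : T * R -> \bar R := fun z => (G z * \1_D z.2)%:E.
have mF : measurable_fun setT F.
  apply/measurable_EFinP; apply: measurable_funM => //.
  by apply: measurableT_comp => //; exact: measurable_indic.
have F1 w : (\int[mu]_t F (w, t) = (\int[mu]_(t in D) G (w, t))%:E)%E.
  rewrite -Rintegral_EFin// [RHS]integral_mkcond; apply: eq_integral => t _.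
  by rewrite /F restrict_EFin/= patchE indicE; case: ifPn => _;
    rewrite ?mulr1 ?mulr0.
have F3 w : (\int[mu]_t `|F (w, t)| = (\int[mu]_(t in D) `|G (w, t)|)%:E)%E.
  rewrite -Rintegral_EFin//; last exact: integrable_normr.
  rewrite [RHS]integral_mkcond; apply: eq_integral => t _.
  by rewrite /F restrict_EFin/= patchE indicE; case: ifPn => _;
    rewrite ?mulr1 ?mulr0 ?normr0.
have F2 t : (\int[P]_w F (w, t) =
    ((EFin \o (fun t => (\int[P]_w G (w, t))%R)) \_ D) t)%E.
  rewrite /F patchE; case: ifPn => [tD|tD].
    rewrite /= -Rintegral_EFin//; last by apply: intG2; exact: set_mem.
    by apply: eq_integral => w _ /=; rewrite indicE tD mulr1.
  by apply: integral0_eq => w _ /=; rewrite indicE (negbTE tD) mulr0.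
have intF : (P \x mu)%E.-integrable setT F.
  apply/integrable12ltyP => //.
  apply: (@le_lt_trans _ _ (\int[P]_w (`|S w| * fine (mu D))%:E)%E).
    apply: ge0_le_integral => //=.
    - by move=> w _; exact: integral_ge0.
    - apply: (@measurable_fun_fubini_tonelli_F _ _ _ _ _ mu
        (fun z => `|F z|%E)) => //.
      exact: measurableT_comp.
    - apply/measurable_EFinP/measurable_funM => //.
      by apply: measurableT_comp => //; exact: integrable_measurable intS.
    - move=> w _; rewrite F3 lee_fin mulrC -[_ * _]mulrC -Rintegral_cst//.
      apply: le_Rintegral => //; first exact: integrable_normr.
        by apply: (@bounded_integrabler _ _ _ _ _ _ `|S w|) => // t _ /=;
          rewrite normr_id.
      by move=> t Dt; rewrite (le_trans (GS w t Dt))// ler_norm.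
  have : P.-integrable setT (EFin \o (fun w => `|S w| * fine (mu D))).
    under eq_fun do rewrite mulrC.
    exact/integrable_mulrl/integrable_normr.
  move/integrable_fin_num => /(_ measurableT); rewrite /comp/= => /fin_numPlt.
  by move=> /andP[].
have intF2 : mu.-integrable D (EFin \o (fun t => \int[P]_w G (w, t))).
  apply: (@bounded_integrabler _ _ _ _ _ _ (\int[P]_w S w)) => //.
    apply/measurable_EFinP/(measurable_restrictT _ mD).
    have := measurable_fubini_G intF; apply: eq_measurable_fun => t _.
    exact: F2.
  by move=> t Dt; apply: le_norm_Rintegral => // w _; exact: GS.
have intF1 : P.-integrable setT (fun w => \int[mu]_t F (w, t))%E.
  exact: (integrable_fubini_F intF).
split.
- apply: EFin_inj; rewrite -Rintegral_EFin//; last first.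
    by move: intF1; under eq_fun do rewrite F1.
  rewrite -Rintegral_EFin//.
  under eq_integral do rewrite -F1.
  rewrite (Fubini intF) [RHS]integral_mkcond.
  by apply: eq_integral => t _; exact: F2.
- exact: intF2.
- by move: intF1; under eq_fun do rewrite F1.
Qed.

End fubini_dominated.

(** * Derivatives of real functions *)

Section derivatives.
Context (R : realType).
Implicit Types (f g : R -> R) (x a b : R).

Lemma is_derive_addr f g x a b : is_derive x 1 f a -> is_derive x 1 g b ->
  is_derive x 1 (fun t => f t + g t) (a + b).
Proof. by move=> fa gb; exact: is_deriveD. Qed.

Lemma is_derive_subr f g x a b : is_derive x 1 f a -> is_derive x 1 g b ->
  is_derive x 1 (fun t => f t - g t) (a - b).
Proof. by move=> fa gb; exact: is_deriveB. Qed.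

Lemma is_derive_mulr f g x a b : is_derive x 1 f a -> is_derive x 1 g b ->
  is_derive x 1 (fun t => f t * g t) (f x * b + g x * a).
Proof. by move=> fa gb; exact: is_deriveM. Qed.

Lemma is_derive_mulrl k f x a : is_derive x 1 f a ->
  is_derive x 1 (fun t => k * f t) (k * a).
Proof. by move=> fa; exact: is_deriveZ. Qed.

Lemma is_derive_sqr x : is_derive x 1 (fun t : R => t ^+ 2) (2 * x).
Proof.
have -> : 2 * x = x * 1 + x * 1 by lra.
exact: (is_derive_mulr (is_derive_id x 1) (is_derive_id x 1)).
Qed.

Lemma is_derive_shiftl f x s a : is_derive (x + s) 1 f a ->
  is_derive x 1 (fun t => f (t + s)) a.
Proof.
move=> fa; have := is_derive_addr (is_derive_id x (1 : R))
  (is_derive_cst s x 1).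
rewrite addr0 => d1; have := @is_derive1_comp _ f _ x a 1 fa d1.
by rewrite mulr1.
Qed.

Lemma continuous_mulr f g : continuous f -> continuous g ->
  continuous (fun t => f t * g t).
Proof. by move=> cf cg x; apply: cvgM; [exact: cf|exact: cg]. Qed.

Lemma continuous_addr f g : continuous f -> continuous g ->
  continuous (fun t => f t + g t).
Proof. by move=> cf cg x; apply: cvgD; [exact: cf|exact: cg]. Qed.

Lemma continuous_subr f g : continuous f -> continuous g ->
  continuous (fun t => f t - g t).
Proof. by move=> cf cg x; apply: cvgB; [exact: cf|exact: cg]. Qed.

Lemma continuous_cstr (c : R) : continuous (fun _ : R => c).
Proof. by move=> x; exact: cst_continuous. Qed.

Lemma continuous_idr : continuous (fun t : R => t).
Proof. by move=> x; exact: cvg_id. Qed.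

Lemma is_derive_continuous f (df : R -> R) :
  (forall x, is_derive x 1 f (df x)) -> continuous f.
Proof.
by move=> dfE x; apply: differentiable_continuous; apply/derivable1_diffP;
  have [] := dfE x.
Qed.

Lemma lipschitz_derivative f (df : R -> R) (M : R) :
  (forall x : R, is_derive x 1 f (df x)) -> (forall x, `|df x| <= M) ->
  forall a b, `|f b - f a| <= M * `|b - a|.
Proof.
move=> dfE dfM.
suff main a b : a <= b -> `|f b - f a| <= M * `|b - a|.
  by move=> a b; have [/main//|/ltW/main] := leP a b;
    rewrite distrC [in leRHS]distrC.
move=> ab; have cf : {within `[a, b], continuous f}.
  by apply: continuous_subspaceT; exact: (is_derive_continuous dfE).
have [c _ ->] := MVT_segment ab (fun x _ => dfE x) cf.
by rewrite normrM ler_wpM2r.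
Qed.

End derivatives.
Arguments continuous_mulr {R f g} _ _.
Arguments continuous_addr {R f g} _ _.
Arguments continuous_subr {R f g} _ _.
Arguments continuous_cstr {R} c.
Arguments continuous_idr {R}.
Arguments is_derive_continuous {R f df} _.

(** * The interpolation kernel *)

Section kernel.
Context (R : realType).
Local Notation mu := (@lebesgue_measure R).
Implicit Types (q Q : R -> R) (y t : R).

Lemma Rintegral_derivative q Q (a b : R) : a <= b ->
  (forall x : R, is_derive x 1 Q (q x)) -> continuous q ->
  \int[mu]_(t in `[a, b]) q t = Q b - Q a.
Proof.
rewrite le_eqVlt => /predU1P[<- _ _|ab dQ cq].
  by rewrite set_itv1 Rintegral_set1 subrr.
have cQ x : {for x, continuous Q} by exact: (is_derive_continuous dQ).
rewrite /Rintegral (@continuous_FTC2 _ q Q)//.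
- by apply: continuous_subspaceT => x; exact: cq.
- split=> [x _||]; first by have [] := dQ x.
    by apply: cvg_at_right_filter; exact: cQ.
  by apply: cvg_at_left_filter; exact: cQ.
- by move=> x _; rewrite derive1E; have [_] := dQ x.
Qed.

Lemma continuous_Rintegrable q (a b : R) : continuous q ->
  mu.-integrable `[a, b] (EFin \o q).
Proof.
move=> cq; apply: continuous_compact_integrable.
  exact: segment_compact.
by apply: continuous_subspaceT => x; exact: cq.
Qed.

(** The range of [t] in the error terms that involve the variance. *)
Definition window : set R := [set t | `|t| <= 1].

Lemma windowE : window = `[-1, 1]%classic.
Proof. by apply/seteqP; split=> t; rewrite /window/= in_itv/= ler_norml. Qed.

Lemma measurable_window : measurable window.
Proof. by rewrite windowE; exact: measurable_itv. Qed.

Lemma lebesgue_window : mu window = 2%:E.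
Proof.
rewrite windowE lebesgue_measure_itv/= lte_fin ifT; last by lra.
by rewrite -EFinB; congr EFin; lra.
Qed.

(** The signed indicator of the segment between [- y] and 0, so that
    [f w - f (w - y)] is the integral of [f' (w + t) * kern y t]. *)
Definition kern y t : R := (- y <= t < 0)%R%:R - (0 <= t <= - y)%R%:R.

Definition clip1 y : R := Num.max (-1) (Num.min y 1).

Variant clip1_spec y : R -> Prop :=
| Clip1Low of y <= -1 : clip1_spec y (-1)
| Clip1Mid of -1 <= y & y <= 1 : clip1_spec y y
| Clip1High of 1 <= y : clip1_spec y 1.

Lemma clip1P y : clip1_spec y (clip1 y).
Proof.
rewrite /clip1; case: (leP y 1) => [y1|/ltW y1].
  case: (leP (-1) y) => [?|/ltW ?]; first exact: Clip1Mid.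
  exact: Clip1Low.
by rewrite max_r; [exact: Clip1High|lra].
Qed.

Lemma measurable_kern d (T : measurableType d) (f g : T -> R) :
  measurable_fun setT f -> measurable_fun setT g ->
  measurable_fun setT (fun x => kern (f x) (g x)).
Proof.
move=> mf mg; apply: measurable_funB; apply: measurable_natr_bool;
  apply: measurable_and;
  do ?[apply: measurable_fun_ler|apply: measurable_fun_ltr] => //;
  exact: measurable_funN.
Qed.

Lemma norm_kern_le1 y t : `|kern y t| <= 1.
Proof.
rewrite /kern; case: (_ <= _ < _); case: (_ <= _ <= _) => /=;
  by rewrite ler_norml; apply/andP; split; lra.
Qed.

(** Restricting the kernel to [|t| <= 1] amounts to truncating [y]. *)
Lemma Rintegral_kern q Q y :
  (forall x : R, is_derive x 1 Q (q x)) -> continuous q ->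
  \int[mu]_(t in window) (q t * kern y t) = Q 0 - Q (- clip1 y).
Proof.
move=> dQ cq; have [y0|y0] := ltP 0 y.
- pose c := clip1 y.
  have c0 : - c <= 0 by rewrite /c; case: clip1P => *; lra.
  transitivity (\int[mu]_(t in window) (q \_ `[-c, 0[) t).
    apply: eq_Rintegral => t /[!inE]; rewrite windowE /= in_itv/=
      => /andP[t1 t2].
    rewrite patchE /kern mem_setE in_itv/= (_ : (0 <= t <= - y) = false);
      last first.
      by apply/negP => /andP[]; lra.
    rewrite subr0 (_ : (- y <= t) = (- c <= t)).
      by case: ifPn => _; rewrite ?mulr1 ?mulr0.
    by apply/idP/idP; rewrite /c; case: clip1P => *; lra.
  rewrite -Rintegral_mkcondr windowE (_ : _ `&` _ = `[-c, 0[%classic);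
    last first.
    apply/seteqP; split=> t /=; rewrite !in_itv/=; first by case.
    move=> /andP[ct t0]; split; rewrite ?ct ?t0//.
    by move: ct; rewrite /c; case: clip1P => *; lra.
  rewrite Rintegral_itv_bndo_bndc; first exact: Rintegral_derivative.
  apply: (integrableS _ _ _ (@continuous_Rintegrable q (- c) 0 cq)) => //.
  by apply: subset_itvl; rewrite bnd_simp.
- pose c := clip1 y.
  have c0 : 0 <= - c by rewrite /c; case: clip1P => *; lra.
  transitivity (\int[mu]_(t in window) (-1 * (q \_ `[0, -c]) t)).
    apply: eq_Rintegral => t /[!inE]; rewrite windowE /= in_itv/=
      => /andP[t1 t2].
    rewrite patchE /kern mem_setE in_itv/= (_ : (- y <= t < 0) = false);
      last first.
      by apply/negP => /andP[]; lra.
    rewrite sub0r (_ : (t <= - y) = (t <= - c)).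
      by case: ifPn => _; rewrite ?mulrN1 ?mulN1r ?oppr0 ?mulr0.
    by apply/idP/idP; rewrite /c; case: clip1P => *; lra.
  have sub : `[0, - c]%classic `<=` window.
    rewrite windowE => t /=; rewrite !in_itv/= => /andP[].
    by rewrite /c; case: clip1P => *; lra.
  rewrite RintegralZl; last 2 first.
  - exact: measurable_window.
  - rewrite -restrict_EFin; apply/integrable_restrict => //.
      exact: measurable_window.
    by rewrite (setIidr sub); exact: continuous_Rintegrable.
  rewrite -Rintegral_mkcondr (setIidr sub) (Rintegral_derivative c0 dQ)//.
  by rewrite mulN1r opprB.
Qed.

Lemma Rintegral_kern1 y : \int[mu]_(t in window) kern y t = clip1 y.
Proof.
have d1 (x : R) : is_derive x 1 id (cst 1 x) by exact: is_derive_id.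
rewrite -[RHS](opprK) -[RHS]add0r -(Rintegral_kern y d1); last first.
  by move=> x; exact: cst_continuous.
by apply: eq_Rintegral => t _; rewrite mul1r.
Qed.

(** [kern y t] is nonnegative for [t < 0] and nonpositive for [t >= 0]; hence
    the first absolute moment of the kernel is again an integral of the form
    computed by [Rintegral_kern]. *)
Lemma normM_kern y t : `|t| * `|kern y t| = - t * kern y t.
Proof.
rewrite /kern; have [t0|t0] := ltP t 0.
  by rewrite andbT subr0 normr_nat ltr0_norm.
by rewrite andbF sub0r normrN normr_nat ger0_norm// mulrNN.
Qed.

Lemma Rintegral_normM_kern y :
  \int[mu]_(t in window) (`|t| * `|kern y t|) = 2^-1 * Num.min (y ^+ 2) 1.
Proof.
under eq_Rintegral do rewrite normM_kern.
have dQ (x : R) : is_derive x 1 (fun t => - 2^-1 * t ^+ 2) (- x).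
  have := is_derive_mulrl (- 2^-1) (is_derive_sqr x).
  by rewrite mulrA mulNr mulVf// mulN1r.
rewrite (Rintegral_kern _ dQ).
- rewrite expr0n/= mulr0 sub0r sqrrN -mulNr opprK; congr (_ * _).
  case: clip1P => [y1|y1 y2|y1].
  + by rewrite min_r ?sqrrN ?expr1n//; nra.
  + by rewrite min_l//; nra.
  + by rewrite min_r ?expr1n//; nra.
- by move=> x; apply: continuousN; exact: cvg_id.
Qed.

End kernel.
Arguments window {R}.

(** * Independence *)

Section product_law.
Context d (T : measurableType d) (R : realType) (P : probability T R).

(** The law of [(Z, V)] agrees with the product of the laws on rectangles,
    hence everywhere, and Fubini's theorem factors the expectation. *)
Lemma independent_mul_mean0 (Z V : {RV P >-> R}) (g : R -> R) :
  (forall B C : set R, measurable B -> measurable C ->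
    P (Z @^-1` B `&` V @^-1` C) = (P (Z @^-1` B) * P (V @^-1` C))%E) ->
  P.-integrable setT (EFin \o Z) -> \int[P]_w Z w = 0 ->
  measurable_fun setT g -> P.-integrable setT (EFin \o (g \o V)) ->
  P.-integrable setT (EFin \o (fun w => Z w * g (V w))) /\
  \int[P]_w (Z w * g (V w)) = 0.
Proof.
move=> indep intZ Z0 mg intg.
have mZV : measurable_fun setT (fun w => (Z w, V w)).
  by apply: measurable_fun_pair; exact: measurable_funP.
pose mixZV := isMeasurableFun.Build _ _ _ _ _ mZV.
pose ZV : {mfun T >-> (R * R)%type} :=
  MeasurableFun.Pack (MeasurableFun.Class mixZV).
pose mZ := distribution P Z; pose mV := distribution P V.
pose f (z : R * R) : \bar R := (z.1 * g z.2)%:E.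
have law X : measurable X -> (mZ \x mV)%E X = distribution P ZV X.
  by apply: product_measure_unique => B C mB mC; rewrite -indep.
have mf : measurable_fun setT f.
  by apply/measurable_EFinP/measurable_funM => //; exact: measurableT_comp.
have intz : mZ.-integrable setT (EFin \o id).
  by apply: integrable_pushforward => //; exact/measurable_EFinP.
have intv : mV.-integrable setT (EFin \o g).
  by apply: integrable_pushforward => //; exact/measurable_EFinP.
have intf : (mZ \x mV)%E.-integrable setT f.
  apply/integrable12ltyP => //.
  rewrite (_ : (\int[mZ]_x _)%E =
      (\int[mZ]_z (\int[mV]_v `|g v| * `|z|)%:E)%E).
    have := integrable_fin_num measurableT
      (integrable_mulrl (\int[mV]_v `|g v|) measurableT
        (integrable_normr measurableT intz)).
    by move=> /fin_numPlt/andP[].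
  apply: eq_integral => z _ /=; rewrite mulrC -RintegralZl//; last first.
    exact: integrable_normr.
  rewrite -Rintegral_EFin//; last exact/integrable_mulrl/integrable_normr.
  by apply: eq_integral => v _; rewrite normrM.
have int_absf : (\int[P]_w `|f (ZV w)| < +oo)%E.
  rewrite -(@ge0_integral_distribution _ _ _ _ _ P ZV (abse \o f));
    last 2 first.
  - exact: measurableT_comp.
  - by move=> y; exact: abse_ge0.
  rewrite -(@eq_measure_integral _ _ _ _ (distribution P ZV) (mZ \x mV)%E).
    by case/integrableP : intf.
  by move=> A mA _; exact: law.
have intP : P.-integrable setT (f \o ZV).
  apply/integrableP; split; last exact: int_absf.
  exact: measurableT_comp.
split; first exact: intP.
apply: EFin_inj; rewrite -Rintegral_EFin//.
rewrite -[LHS](@integral_distribution _ _ _ _ _ P ZV f)//.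
rewrite -(@eq_measure_integral _ _ _ _ (distribution P ZV) (mZ \x mV)%E);
  last first.
  by move=> A mA _; exact: law.
rewrite -(integral12_prod_meas1 intf) /fubini_F.
transitivity (\int[mZ]_z (\int[mV]_v g v * z)%:E)%E.
  apply: eq_integral => z _; rewrite mulrC -RintegralZl//.
  by rewrite -Rintegral_EFin//; exact: integrable_mulrl.
rewrite Rintegral_EFin//; last exact: integrable_mulrl.
rewrite RintegralZl//.
suff -> : \int[mZ]_z z = 0 by rewrite mulr0.
rewrite -Z0 /Rintegral (@integral_distribution _ _ _ _ _ P Z (EFin \o id))//.
exact/measurable_EFinP.
Qed.

End product_law.

(** * The Gaussian density *)

Section gaussian.
Context (R : realType).
Local Notation mu := (@lebesgue_measure R).

Lemma is_derive_Rintegral_Ny (q : R -> R) (w : R) :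
  mu.-integrable setT (EFin \o q) -> continuous q ->
  is_derive w 1 (fun x => \int[mu]_(t in `]-oo, x]) q t) (q w).
Proof.
move=> intq cq.
have w1 : w < w + 1 by rewrite ltrDl.
have intw : mu.-integrable [set` Interval -oo%O (BRight (w + 1))] (EFin \o q).
  exact: integrableS intq.
have [|dF dFE] := continuous_FTC1 w1 intw _ (cq w); first by rewrite /= ltNyr.
by split; [exact: dF|rewrite -derive1E].
Qed.

Definition gauss_pdf : R -> R := normal_pdf 0 1.

Lemma gauss_pdfE x : gauss_pdf x = normal_peak 1 * expR (- x ^+ 2 / 2).
Proof.
by rewrite /gauss_pdf normal_pdfE ?oner_neq0// /normal_fun subr0 expr1n.
Qed.

Lemma gauss_pdf_gt0 x : 0 < gauss_pdf x.
Proof. by rewrite gauss_pdfE mulr_gt0 ?expR_gt0// normal_peak_gt0. Qed.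

Lemma continuous_gauss_pdf : continuous gauss_pdf.
Proof. by apply: continuous_normal_pdf; exact: oner_neq0. Qed.

Lemma integrable_gauss_pdf : mu.-integrable setT (EFin \o gauss_pdf).
Proof. exact: integrable_normal_pdf. Qed.

Lemma is_derive_gauss_pdf (x : R) : is_derive x 1 gauss_pdf (- x * gauss_pdf x).
Proof.
have d1 : is_derive x 1 (fun t : R => - 2^-1 * t ^+ 2) (- x).
  have := is_derive_mulrl (- 2^-1) (is_derive_sqr x).
  by rewrite mulrA mulNr mulVf// mulN1r.
have pdfE : gauss_pdf =
    (fun t => normal_peak 1 * (expR \o (fun t => - 2^-1 * t ^+ 2)) t).
  by apply/funext => t; rewrite gauss_pdfE /=; congr (_ * expR _); lra.
have := is_derive_mulrl (normal_peak 1) (is_derive1_comp (is_derive_expR _) d1).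
rewrite -pdfE => /is_derive_eq; apply.
by rewrite [in RHS]pdfE /= mulrA mulrC.
Qed.

Lemma normal_peak1_le : normal_peak 1 <= 2^-1 :> R.
Proof.
rewrite /normal_peak expr1n mul1r lef_pV2 ?posrE//; last first.
  by rewrite sqrtr_gt0 pmulrn_lgt0// pi_gt0.
rewrite -(@ler_sqr _ 2)// ?nnegrE ?sqrtr_ge0// sqr_sqrtr; last first.
  by rewrite pmulrn_lge0// pi_ge0.
have := @pi_ge2 R; lra.
Qed.

Lemma normal_peak1_ge : 3^-1 <= normal_peak 1 :> R.
Proof.
rewrite /normal_peak expr1n mul1r lef_pV2 ?posrE//; last first.
  by rewrite sqrtr_gt0 pmulrn_lgt0// pi_gt0.
rewrite -(@ler_sqr _ _ 3)// ?nnegrE ?sqrtr_ge0// sqr_sqrtr; last first.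
  by rewrite pmulrn_lge0// pi_ge0.
have := @pihalf_lt2 R; lra.
Qed.

Lemma gauss_pdf_le x : gauss_pdf x <= 2^-1.
Proof.
by apply: le_trans normal_peak1_le; apply: normal_pdf_ub; exact: oner_neq0.
Qed.

(** A crude lower bound is enough: it only enters the bound on Stein's
    solution near the origin. *)
Lemma gauss_pdf_ge x : `|x| <= 1 -> 6^-1 <= gauss_pdf x.
Proof.
move=> x1; rewrite gauss_pdfE.
have x2 : x ^+ 2 <= 1 by rewrite -real_normK ?num_real// expr_le1.
have := expR_ge1Dx (- x ^+ 2 / 2); have := normal_peak1_ge.
set e := expR _; set p := normal_peak 1 => p3 e1.
have e2 : 2^-1 <= e by lra.
have := ler_pM _ _ p3 e2; lra.
Qed.

Definition gauss_cdf (x : R) : R := \int[mu]_(t in `]-oo, x]) gauss_pdf t.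

Lemma EFin_gauss_cdf x : (gauss_cdf x)%:E = std_normal_cdf x.
Proof.
rewrite /gauss_cdf -Rintegral_EFin//.
exact: integrableS integrable_gauss_pdf.
Qed.

Lemma is_derive_gauss_cdf (x : R) : is_derive x 1 gauss_cdf (gauss_pdf x).
Proof.
apply: is_derive_Rintegral_Ny; first exact: integrable_gauss_pdf.
exact: continuous_gauss_pdf.
Qed.

Lemma gauss_cdf_ge0 x : 0 <= gauss_cdf x.
Proof. by apply: Rintegral_ge0 => t _; exact/ltW/gauss_pdf_gt0. Qed.

Lemma Rintegral_gauss_pdf : \int[mu]_t gauss_pdf t = 1.
Proof. by rewrite /Rintegral integral_normal_pdf. Qed.

Lemma gauss_cdf_compl x : \int[mu]_(t in `]x, +oo[) gauss_pdf t =
  1 - gauss_cdf x.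
Proof.
have /= := @Rintegral_itvB R gauss_pdf -oo%O +oo%O x.
rewrite set_itvNyy Rintegral_gauss_pdf => <- //.
exact: integrable_gauss_pdf.
Qed.

Lemma gauss_cdf_le1 x : gauss_cdf x <= 1.
Proof.
rewrite -subr_ge0 -gauss_cdf_compl.
by apply: Rintegral_ge0 => t _; exact/ltW/gauss_pdf_gt0.
Qed.

Lemma gauss_cdf_le_bound c x : (forall y, x <= y -> gauss_cdf y <= c) -> 1 <= c.
Proof.
move=> cdfc; rewrite -lee_fin.
pose N : probability (measurableTypeR R) R := normal_prob 0 1.
pose mixid := isMeasurableFun.Build _ _ (measurableTypeR R)
  R id (@measurable_id _ R setT).
pose Z : {RV N >-> R} := MeasurableFun.Pack (MeasurableFun.Class mixid).
have := @cvg_cdfy1 _ _ R N Z.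
apply: cvge_le; near=> y; rewrite /cdf/= /distribution/= /pushforward/=.
rewrite -[X in (X <= _)%E]/(std_normal_cdf y) -EFin_gauss_cdf lee_fin;
  apply: cdfc.
by near: y; apply: nbhs_pinfty_ge; exact: num_real.
Unshelve. all: end_near. Qed.

Lemma gauss_cdf_ge_bound c x : (forall y, y <= x -> c <= gauss_cdf y) -> c <= 0.
Proof.
move=> cdfc; rewrite -lee_fin.
pose N : probability (measurableTypeR R) R := normal_prob 0 1.
pose mixid := isMeasurableFun.Build _ _ (measurableTypeR R)
  R id (@measurable_id _ R setT).
pose Z : {RV N >-> R} := MeasurableFun.Pack (MeasurableFun.Class mixid).
have := @cvg_cdfNy0 _ _ R N Z.
apply: cvge_ge; near=> y; rewrite /cdf/= /distribution/= /pushforward/=.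
rewrite -[X in (_ <= X)%E]/(std_normal_cdf y) -EFin_gauss_cdf lee_fin;
  apply: cdfc.
by near: y; apply: nbhs_ninfty_le; exact: num_real.
Unshelve. all: end_near. Qed.

(** The Mills ratio bounds come from the sign of the derivative of
    [x |-> gauss_pdf x + w * gauss_cdf x], namely of [(w - x) * gauss_pdf x]:
    the function is largest at [x = w]. *)
Lemma gauss_mills_aux w x :
  gauss_pdf x + w * gauss_cdf x <= gauss_pdf w + w * gauss_cdf w.
Proof.
pose k t := gauss_pdf t + w * gauss_cdf t.
have dk (t : R) : is_derive t 1 k ((w - t) * gauss_pdf t).
  have := is_derive_addr (is_derive_gauss_pdf t)
    (is_derive_mulrl w (is_derive_gauss_cdf t)).
  by rewrite -mulrDl addrC.
have ck a b : {within `[a, b], continuous k}.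
  by apply: continuous_subspaceT; exact: (is_derive_continuous dk).
rewrite -/(k x) -/(k w) -subr_ge0; have [xw|/ltW wx] := leP x w.
  have [c] := MVT_segment xw (fun t _ => dk t) (ck _ _).
  rewrite in_itv/= => /andP[xc cw] ->.
  by rewrite mulr_ge0 ?mulr_ge0 ?subr_ge0// ltW// gauss_pdf_gt0.
have [c] := MVT_segment wx (fun t _ => dk t) (ck _ _).
rewrite in_itv/= => /andP[wc cx] kE.
rewrite -oppr_le0 opprB kE mulr_le0_ge0 ?subr_ge0//.
by rewrite mulr_le0_ge0 ?subr_le0// ltW// gauss_pdf_gt0.
Qed.

Lemma gauss_mills_pos w : 0 <= w -> w * (1 - gauss_cdf w) <= gauss_pdf w.
Proof.
rewrite le_eqVlt => /predU1P[<-|w0]; first by rewrite mul0r ltW// gauss_pdf_gt0.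
suff : 1 <= gauss_pdf w / w + gauss_cdf w.
  by rewrite -lerBlDr ler_pdivlMr// mulrC.
apply: (@gauss_cdf_le_bound _ 0) => y _.
rewrite -lerBlDr ler_pdivlMr// mulrC mulrBr lerBlDr.
apply: le_trans (gauss_mills_aux w y).
by rewrite lerDr ltW// gauss_pdf_gt0.
Qed.

Lemma gauss_mills_neg w : w <= 0 -> - w * gauss_cdf w <= gauss_pdf w.
Proof.
rewrite le_eqVlt => /predU1P[->|w0].
  by rewrite oppr0 mul0r ltW// gauss_pdf_gt0.
set K := gauss_pdf w + w * gauss_cdf w.
suff : K / w <= 0 by rewrite nmulr_lle0 ?invr_lt0// /K; lra.
apply: (@gauss_cdf_ge_bound _ 0) => y _.
rewrite ler_ndivrMr// mulrC; apply: le_trans (gauss_mills_aux w y).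
by rewrite lerDr ltW// gauss_pdf_gt0.
Qed.

End gaussian.
Arguments continuous_gauss_pdf {R}.

(** * Ramps *)

Section ramp.
Context (R : realType).
Local Notation mu := (@lebesgue_measure R).
Implicit Types (l x t : R).

Definition ramp l x : R := Num.max 0 (Num.min 1 (x / l)).

Lemma ramp_low l x : 0 < l -> x <= 0 -> ramp l x = 0.
Proof.
by move=> l0 x0; rewrite /ramp max_l// ge_min orbC ler_pdivrMr// mul0r x0.
Qed.

Lemma ramp_mid l x : 0 < l -> 0 <= x -> x <= l -> ramp l x = x / l.
Proof.
move=> l0 x0 xl; rewrite /ramp min_r ?ler_pdivrMr ?mul1r//.
by rewrite max_r// divr_ge0// ltW.
Qed.

Lemma ramp_high l x : 0 < l -> l <= x -> ramp l x = 1.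
Proof. by move=> l0 xl; rewrite /ramp min_l ?ler_pdivlMr ?mul1r// max_r. Qed.

Lemma ramp_ge0 l x : 0 <= ramp l x.
Proof. by rewrite /ramp le_max lexx. Qed.

Lemma ramp_le1 l x : ramp l x <= 1.
Proof. by rewrite /ramp ge_max ler01 ge_min lexx. Qed.

Lemma ramp_homo l x y : 0 < l -> x <= y -> ramp l x <= ramp l y.
Proof.
move=> l0 xy; rewrite /ramp le_max2// le_min2//.
by rewrite ler_pM2r ?invr_gt0.
Qed.

Lemma continuous_ramp l : continuous (ramp l).
Proof.
move=> x.
apply: (@continuous_max R R (cst 0) (fun y => Num.min 1 (y / l)) x).
  exact: cst_continuous.
apply: (@continuous_min R R (cst 1) (fun y => y / l) x).
  exact: cst_continuous.
by apply: continuousM; [exact: cvg_id|exact: cst_continuous].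
Qed.

Lemma continuous_ramp_shift l c : continuous (fun x => ramp l (x - c)).
Proof.
move=> x; apply: (@continuous_comp _ _ _ (fun y : R => y - c) (ramp l)).
  by apply: continuousB; [exact: cvg_id|exact: cst_continuous].
exact: continuous_ramp.
Qed.

Lemma measurable_ramp l : measurable_fun setT (ramp l).
Proof. by apply: continuous_measurable_fun; exact: continuous_ramp. Qed.

Lemma Rintegral_itv_bool (D : set R) (a b : R) : measurable D ->
  \int[mu]_(u in D) (a <= u <= b)%R%:R = fine (mu (D `&` `[a, b])).
Proof.
move=> mD; rewrite -[RHS]mul1r -Rintegral_cst; last exact: measurableI.
rewrite Rintegral_mkcondr; apply: eq_Rintegral => u _.
by rewrite patchE mem_setE in_itv/=; case: ifP.
Qed.

(** The ramp is the primitive of the density [l^-1] on [[0, l]]. *)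
Lemma ramp_increment l x t : 0 < l -> 0 <= t ->
  ramp l (x + t) - ramp l x =
  l^-1 * \int[mu]_(u in `[0, t]) (0 <= x + u <= l)%R%:R.
Proof.
move=> l0 t0.
transitivity (l^-1 * \int[mu]_(u in `[0, t]) (- x <= u <= l - x)%R%:R);
  last first.
  congr (_ * _); apply: eq_Rintegral => u _; congr (nat_of_bool _)%:R.
  by congr andb; apply/idP/idP => ?; lra.
rewrite Rintegral_itv_bool//.
rewrite (_ : _ `&` _ = `[Num.max 0 (- x), Num.min t (l - x)]%classic);
  last first.
  apply/seteqP; split=> u /=; rewrite !in_itv/= ge_max le_min.
    by move=> [/andP[-> ->] /andP[-> ->]].
  by move=> /andP[/andP[-> ->] /andP[-> ->]].
rewrite lebesgue_measure_itv/= lte_fin.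
set lo := Num.max _ _; set hi := Num.min _ _.
rewrite (_ : fine _ = Num.max 0 (hi - lo)); last first.
  case: ltP => lohi; first by rewrite -EFinB/= max_r// subr_ge0 ltW.
  by rewrite max_l// subr_le0.
rewrite /lo /hi; have [x0|/ltW x0] := leP x 0.
  rewrite (ramp_low l0 x0) subr0 [Num.max 0 (- x)]max_r ?oppr_ge0//.
  have [xt|/ltW xt] := leP (x + t) 0.
    by rewrite (ramp_low l0 xt) max_l ?mulr0// min_l; lra.
  have [xl|/ltW xl] := leP (x + t) l.
    rewrite (ramp_mid l0 xt xl) min_l; last by lra.
    by rewrite max_r ?opprK; [rewrite mulrC addrC|lra].
  rewrite (ramp_high l0 xl) min_r; last by lra.
  by rewrite max_r ?opprK ?subrK ?mulVf ?gt_eqF// ltW.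
rewrite [Num.max 0 (- x)]max_l ?oppr_le0// subr0.
have [xl|/ltW xl] := leP x l; last first.
  rewrite !ramp_high//; last by lra.
  by rewrite subrr max_l ?mulr0// min_r; lra.
rewrite (ramp_mid l0 x0 xl); have [xt|/ltW xt] := leP (x + t) l.
  rewrite (ramp_mid l0 _ xt); last by lra.
  rewrite min_l; last by lra.
  by rewrite max_r// -mulrBl addrC addKr mulrC.
rewrite (ramp_high l0 xt) min_r; last by lra.
by rewrite max_r ?subr_ge0// mulrBr mulVf ?gt_eqF// mulrC.
Qed.

End ramp.
Arguments continuous_ramp {R} l.
Arguments continuous_ramp_shift {R} l c.

(** * Stein's equation *)

Section stein_solution.
Context (R : realType).
Local Notation mu := (@lebesgue_measure R).
Local Notation pdf := (@gauss_pdf R).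
Local Notation cdf := (@gauss_cdf R).

Definition gauss_mean (h : R -> R) : R := \int[mu]_t (h t * pdf t).

Definition stein_sol (h : R -> R) (w : R) : R :=
  \int[mu]_(t in `]-oo, w]) ((h t - gauss_mean h) * pdf t) / pdf w.

Definition stein_deriv (h : R -> R) (w : R) : R :=
  w * stein_sol h w + h w - gauss_mean h.

Context (h : R -> R).
Hypothesis hc : continuous h.
Hypothesis h_anti : forall x y, x <= y -> h y <= h x.
Hypothesis h_ge0 : forall x, 0 <= h x.
Hypothesis h_le1 : forall x, h x <= 1.

Local Notation Nh := (gauss_mean h).
Let H w : R := \int[mu]_(t in `]-oo, w]) ((h t - Nh) * pdf t).
Let A w : R := \int[mu]_(t in `]-oo, w]) (h t * pdf t).
Let B w : R := \int[mu]_(t in `]w, +oo[) (h t * pdf t).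

Let int_pdf (D : set R) : measurable D -> mu.-integrable D (EFin \o pdf).
Proof. by move=> mD; exact: integrableS (integrable_gauss_pdf R). Qed.

Let int_hpdf (D : set R) : measurable D ->
  mu.-integrable D (EFin \o (fun t => h t * pdf t)).
Proof.
move=> mD; apply: (@le_integrable_mul_bounded _ _ _ _ _ _ _ 1) => //.
- by apply: measurable_funTS; exact: continuous_measurable_fun.
- by move=> x _; rewrite ger0_norm.
- exact: int_pdf.
Qed.

Let pdf_gt0 w : 0 < pdf w := gauss_pdf_gt0 w.
Let pdf_ge0 w : 0 <= pdf w := ltW (pdf_gt0 w).

Let HE w : H w = A w - Nh * cdf w.
Proof.
rewrite /H /A; under eq_Rintegral do rewrite mulrBl.
by rewrite RintegralB ?RintegralZl//; [exact: int_pdf|exact: int_hpdf|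
  exact/integrable_mulrl/int_pdf].
Qed.

Let NhE w : Nh = A w + B w.
Proof.
have /= := @Rintegral_itvB R (fun t => h t * pdf t) -oo%O +oo%O w.
rewrite set_itvNyy => E; rewrite /A /B -E ?subrKC//.
exact: int_hpdf.
Qed.

Let A_le w : A w <= cdf w.
Proof.
by apply: le_Rintegral => // [||x _]; [exact: int_hpdf|exact: int_pdf|
  rewrite ler_piMl].
Qed.

Let A_ge w : h w * cdf w <= A w.
Proof.
rewrite /cdf -RintegralZl//; last exact: int_pdf.
apply: le_Rintegral => // [||x]; [exact/integrable_mulrl/int_pdf|
  exact: int_hpdf|].
by rewrite /= in_itv/= => xw; rewrite ler_wpM2r// h_anti.
Qed.

Let B_ge0 w : 0 <= B w.
Proof. by apply: Rintegral_ge0 => x _; rewrite mulr_ge0. Qed.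

Let B_le w : B w <= h w * (1 - cdf w).
Proof.
rewrite -gauss_cdf_compl -RintegralZl//; last exact: int_pdf.
apply: le_Rintegral => // [||x]; [exact: int_hpdf|
  exact/integrable_mulrl/int_pdf|].
by rewrite /= in_itv/= andbT => /ltW xw; rewrite ler_wpM2r// h_anti.
Qed.

Lemma gauss_mean_ge0 : 0 <= Nh.
Proof. by apply: Rintegral_ge0 => x _; rewrite mulr_ge0. Qed.

Lemma gauss_mean_le1 : Nh <= 1.
Proof.
by rewrite -(Rintegral_gauss_pdf R); apply: le_Rintegral => // [||x _];
  [exact: int_hpdf|exact: int_pdf|rewrite ler_piMl].
Qed.

(** With [A] and [B] the integrals of [h * pdf] below and above [w],
    [H = A (1 - cdf) - B cdf], and [h w] separates the values of [h] below [w]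
    from those above. *)
Let H_ge0 w : 0 <= H w.
Proof.
rewrite HE (NhE w); have := A_ge w; have := B_le w.
have := gauss_cdf_ge0 w; have := gauss_cdf_le1 w.
set a := A w; set b := B w; set c := cdf w; set k := h w => c1 c0 bk ak.
have : k * c * (1 - c) <= a * (1 - c) by rewrite ler_wpM2r// subr_ge0.
have : b * c <= k * (1 - c) * c by rewrite ler_wpM2r.
lra.
Qed.

Let H_le_upper w : H w <= Nh * (1 - cdf w).
Proof.
by rewrite HE (NhE w); have := B_ge0 w; lra.
Qed.

Let H_le_lower w : H w <= (1 - Nh) * cdf w.
Proof. by rewrite HE; have := A_le w; lra. Qed.

Let solM w : stein_sol h w * pdf w = H w.
Proof. by rewrite /stein_sol divfK// gt_eqF. Qed.

Lemma stein_sol_ge0 w : 0 <= stein_sol h w.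
Proof. by rewrite divr_ge0//; exact: H_ge0. Qed.

Let w_sol_pos w : 0 <= w -> w * stein_sol h w <= Nh.
Proof.
move=> w0; rewrite -(ler_pM2r (pdf_gt0 w)) -mulrA solM.
apply: (le_trans (ler_wpM2l w0 (H_le_upper w))).
by rewrite mulrCA ler_wpM2l ?gauss_mean_ge0// gauss_mills_pos.
Qed.

Let w_sol_neg w : w <= 0 -> - w * stein_sol h w <= 1 - Nh.
Proof.
move=> w0; rewrite -(ler_pM2r (pdf_gt0 w)) -mulrA solM.
have w0' : 0 <= - w by rewrite oppr_ge0.
apply: (le_trans (ler_wpM2l w0' (H_le_lower w))).
by rewrite mulrCA ler_wpM2l ?subr_ge0 ?gauss_mean_le1// gauss_mills_neg.
Qed.

(** For [w >= 0] the Mills ratio gives [0 <= w * stein_sol w <= Nh], hence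
    [- Nh <= stein_deriv w <= h w]; the case [w <= 0] is symmetric. *)
Lemma stein_deriv_le1 w : `|stein_deriv h w| <= 1.
Proof.
have := gauss_mean_ge0; have := gauss_mean_le1; have := h_ge0 w.
have := h_le1 w; have s0 := stein_sol_ge0 w.
rewrite /stein_deriv => h1 h0 N1 N0; rewrite ler_norml.
have [w0|/ltW w0] := leP 0 w.
  have := w_sol_pos w0; have := mulr_ge0 w0 s0.
  by move=> *; apply/andP; split; lra.
have w0' : 0 <= - w by rewrite oppr_ge0.
have := w_sol_neg w0; have := mulr_ge0 w0' s0.
by move=> *; apply/andP; split; lra.
Qed.

(** Away from the origin the bound on [w * stein_sol w] suffices; on [[-1, 1]]
    the density is at least [1 / 6]. *)
Lemma stein_sol_le6 w : stein_sol h w <= 6.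
Proof.
have := gauss_mean_ge0; have := gauss_mean_le1; have s0 := stein_sol_ge0 w.
move=> N1 N0; have [w1|w1] := leP `|w| 1.
  rewrite ler_pdivrMr//; apply: (@le_trans _ _ 1).
    have := H_le_upper w; rewrite -/(H w).
    have := gauss_cdf_ge0 w; have := gauss_cdf_le1 w; nra.
  have := gauss_pdf_ge w1; lra.
have [w0|/ltW w0] := leP 0 w.
  by have := w_sol_pos w0; move: w1; rewrite ger0_norm//; nra.
by have := w_sol_neg w0; move: w1; rewrite ler0_norm//; nra.
Qed.

Lemma is_derive_stein_sol (w : R) :
  is_derive w 1 (stein_sol h) (stein_deriv h w).
Proof.
have cq : continuous (fun t => (h t - Nh) * pdf t).
  apply: continuous_mulr; last exact: continuous_gauss_pdf.
  exact: continuous_subr hc (continuous_cstr _).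
have intq : mu.-integrable setT (EFin \o (fun t => (h t - Nh) * pdf t)).
  rewrite (_ : (fun t => _) = (fun t => h t * pdf t - Nh * pdf t)).
    apply: integrable_subr => //; first exact: int_hpdf.
    exact/integrable_mulrl/int_pdf.
  by apply/funext => t; rewrite mulrBl.
have dH := is_derive_Rintegral_Ny w intq cq.
have pdf0 : pdf w != 0 by rewrite gt_eqF.
have dV := is_deriveV pdf0 (is_derive_gauss_pdf w).
have := is_derive_mulr dH dV.
move/is_derive_eq; apply; rewrite /= /stein_deriv /stein_sol.
set I := Rintegral _ _ _; rewrite /GRing.scale/=.
by field.
Qed.

Lemma stein_equation w :
  stein_deriv h w - w * stein_sol h w = h w - gauss_mean h.
Proof. by rewrite /stein_deriv; lra. Qed.

Lemma continuous_stein_deriv : continuous (stein_deriv h).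
Proof.
apply: continuous_subr (continuous_cstr _).
apply: continuous_addr hc.
exact: continuous_mulr continuous_idr (is_derive_continuous
  is_derive_stein_sol).
Qed.

Lemma stein_sol_lipschitz a b : `|stein_sol h b - stein_sol h a| <= `|b - a|.
Proof.
have := lipschitz_derivative is_derive_stein_sol stein_deriv_le1 a b.
by rewrite mul1r.
Qed.

(** Up to a constant, subtracting [h] leaves [w * stein_sol w], a product of two
    Lipschitz functions. *)
Lemma stein_deriv_increment w t :
  `|(stein_deriv h (w + t) - h (w + t)) - (stein_deriv h w - h w)| <=
  (`|w| + 6) * `|t|.
Proof.
rewrite (_ : _ - _ = w * (stein_sol h (w + t) - stein_sol h w) +
    t * stein_sol h (w + t)); last by rewrite /stein_deriv; lra.
rewrite mulrDl (le_trans (ler_normD _ _))// lerD//.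
  rewrite normrM ler_wpM2l// (le_trans (stein_sol_lipschitz _ _))//.
  by rewrite addrAC subrr add0r.
rewrite normrM mulrC ler_wpM2r// ger0_norm ?stein_sol_ge0//.
exact: stein_sol_le6.
Qed.

End stein_solution.
Arguments continuous_stein_deriv {R h} _ _ _ _.

(** * Smoothed half-lines *)

Section gauss_mean_ramp.
Context (R : realType).
Local Notation mu := (@lebesgue_measure R).
Local Notation pdf := (@gauss_pdf R).

Definition smooth_step (z l x : R) : R := 1 - ramp l (x - z).

Lemma continuous_smooth_step z l : continuous (smooth_step z l).
Proof.
exact: continuous_subr (continuous_cstr _) (continuous_ramp_shift _ _).
Qed.
Arguments continuous_smooth_step : clear implicits.

Lemma smooth_step_ge0 z l x : 0 <= smooth_step z l x.
Proof. by rewrite subr_ge0 ramp_le1. Qed.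

Lemma smooth_step_le1 z l x : smooth_step z l x <= 1.
Proof. by rewrite lerBlDr lerDl ramp_ge0. Qed.

Lemma smooth_step_anti z l : 0 < l ->
  forall x y, x <= y -> smooth_step z l y <= smooth_step z l x.
Proof. by move=> l0 x y xy; rewrite lerB// ramp_homo// lerB. Qed.

Lemma Rintegral_ramp_mid (z l : R) : 0 < l ->
  \int[mu]_(x in `[z, z + l]) ramp l (x - z) = l / 2.
Proof.
move=> l0.
have dQ (x : R) : is_derive x 1 (fun t => (2 * l)^-1 * (t - z) ^+ 2) ((x - z)
  / l).
  have dz := is_derive_subr (is_derive_id x 1) (is_derive_cst z x 1).
  have := is_derive_mulrl (2 * l)^-1 (is_derive_mulr dz dz).
  rewrite (_ : (fun t => _) = (fun t => (2 * l)^-1 * (t - z) ^+ 2)) //.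
  by move/is_derive_eq; apply; rewrite /=; field; rewrite gt_eqF.
transitivity (\int[mu]_(x in `[z, z + l]) ((x - z) / l)).
  apply: eq_Rintegral => x; rewrite mem_setE in_itv/= => /andP[zx xl].
  by rewrite ramp_mid ?subr_ge0//; lra.
rewrite (Rintegral_derivative _ dQ).
- by rewrite subrr expr0n/= mulr0 subr0 addrAC subrr add0r; field;
  rewrite gt_eqF.
- by rewrite lerDl ltW.
- apply: continuous_mulr (continuous_cstr _).
  exact: continuous_subr continuous_idr (continuous_cstr _).
Qed.

Let int_pdf (D : set R) : measurable D -> mu.-integrable D (EFin \o pdf).
Proof. by move=> mD; exact: integrableS (integrable_gauss_pdf R). Qed.

Let int_bounded_pdf (D : set R) (q : R -> R) : measurable D -> continuous q ->
  (forall x, 0 <= q x <= 1) ->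
  mu.-integrable D (EFin \o (fun t => q t * pdf t)).
Proof.
move=> mD cq q01; apply: (@le_integrable_mul_bounded _ _ _ _ _ _ _ 1) => //.
- by apply: measurable_funTS; exact: continuous_measurable_fun.
- by move=> x _; have /andP[q0 q1] := q01 x; rewrite ger0_norm.
- exact: int_pdf.
Qed.

(** The Gaussian density is at most [1 / 2]. *)
Lemma Rintegral_gauss_pdf_le (D : set R) (q : R -> R) (a b : R) :
  measurable D -> continuous q -> (forall x, 0 <= q x <= 1) ->
  (forall x, D x -> x \notin `[a, b] -> q x = 0) ->
  \int[mu]_(x in D) (q x * pdf x) <= 2^-1 * \int[mu]_(x in `[a, b]) q x.
Proof.
move=> mD cq q01 q0.
have intq : mu.-integrable setT (EFin \o (q \_ `[a, b])).
  rewrite -restrict_EFin; apply/integrable_restrict => //.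
  by rewrite setTI; exact: continuous_Rintegrable.
rewrite Rintegral_mkcond [in leRHS]Rintegral_mkcond -RintegralZl//.
apply: le_Rintegral => //; last first.
- move=> x _; rewrite !patchE mem_setE; have /andP[qx0 qx1] := q01 x.
  case: ifPn => xD; case: ifPn => xab.
  + by rewrite mulrC ler_wpM2r// gauss_pdf_le.
  + by rewrite q0 ?mul0r ?mulr0//; exact: set_mem.
  + by rewrite mulr_ge0.
  + by rewrite mulr0.
- exact: integrable_mulrl.
- rewrite -restrict_EFin; apply/integrable_restrict => //.
  by rewrite setTI; exact: int_bounded_pdf.
Qed.

Lemma Rintegral_smooth_step (z l : R) : 0 < l ->
  \int[mu]_(x in `[z, z + l]) smooth_step z l x = l / 2.
Proof.
move=> l0; rewrite /smooth_step RintegralB//.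
- rewrite Rintegral_ramp_mid// Rintegral_cst// mul1r.
  have E : fine (mu `[z, z + l]%classic) = l.
    by rewrite lebesgue_measure_itv/= lte_fin ltrDl l0 -EFinB/=
      addrAC subrr add0r.
  by rewrite [X in X - _]E; lra.
- exact: continuous_Rintegrable (continuous_cstr _).
- exact: continuous_Rintegrable (continuous_ramp_shift _ _).
Qed.

Lemma gauss_mean_splitE (h : R -> R) (z : R) : continuous h -> (forall x, 0 <=
  h x <= 1) ->
  gauss_mean h = \int[mu]_(x in `]-oo, z]) (h x * pdf x) +
                 \int[mu]_(x in `]z, +oo[) (h x * pdf x).
Proof.
move=> hc h01; have /= := @Rintegral_itvB R (fun t => h t * pdf t)
  -oo%O +oo%O z.
by rewrite set_itvNyy => <-; rewrite ?subrKC//; exact: int_bounded_pdf.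
Qed.

Let step01 (z l x : R) : 0 <= smooth_step z l x <= 1.
Proof. by rewrite smooth_step_ge0 smooth_step_le1. Qed.

Lemma gauss_mean_smooth_step_le (z l : R) : 0 < l ->
  gauss_mean (smooth_step z l) <= gauss_cdf z + l / 4.
Proof.
move=> l0; rewrite (gauss_mean_splitE z (continuous_smooth_step _ _)
  (step01 _ _)).
apply: lerD.
  apply: le_Rintegral => // [||x _].
  - exact: int_bounded_pdf (continuous_smooth_step _ _) (step01 _ _).
  - exact: int_pdf.
  - by rewrite ler_piMl ?smooth_step_le1// ltW// gauss_pdf_gt0.
apply: (@le_trans _ _ (2^-1 * (l / 2))); last by lra.
rewrite -(Rintegral_smooth_step z l0).
apply: Rintegral_gauss_pdf_le => //; first exact: continuous_smooth_step.
move=> x; rewrite /= !in_itv/= andbT => zx; rewrite (ltW zx)/= -ltNge => xl.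
by rewrite /smooth_step ramp_high ?subrr//; lra.
Qed.

Lemma gauss_mean_smooth_step_ge (z l : R) : 0 < l ->
  gauss_cdf z - l / 4 <= gauss_mean (smooth_step (z - l) l).
Proof.
move=> l0.
rewrite (gauss_mean_splitE z (continuous_smooth_step _ _) (step01 _ _)).
set h := smooth_step (z - l) l.
set A := Rintegral _ _ _; set B := Rintegral _ _ _.
have B0 : 0 <= B.
  apply: Rintegral_ge0 => x _.
  by rewrite mulr_ge0 ?smooth_step_ge0// ltW// gauss_pdf_gt0.
suff : gauss_cdf z - A <= l / 4 by move=> ?; lra.
rewrite /A /gauss_cdf -RintegralB//; last 2 first.
- exact: int_pdf.
- exact: int_bounded_pdf (continuous_smooth_step _ _) (step01 _ _).
apply: (@le_trans _ _ (2^-1 * (l / 2))); last by lra.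
rewrite -(Rintegral_ramp_mid (z - l) l0).
rewrite [leLHS](_ : _ =
    \int[mu]_(x in `]-oo, z]) (ramp l (x - (z - l)) * pdf x)); last first.
  by apply: eq_Rintegral => x _; rewrite /h /smooth_step; lra.
apply: Rintegral_gauss_pdf_le => //; first exact: continuous_ramp_shift.
  by move=> x; rewrite ramp_ge0 ramp_le1.
move=> x; rewrite /= !in_itv/= subrK => -> /=; rewrite andbT -ltNge => xl.
by rewrite ramp_low//; lra.
Qed.

End gauss_mean_ramp.
Arguments continuous_smooth_step {R} z l.

(** * Square integrability *)

Section square_integrable.
Context d (T : measurableType d) (R : realType) (P : probability T R).
Implicit Types f g : T -> R.

Definition square_integrable f :=
  measurable_fun setT f /\ P.-integrable setT (EFin \o (fun w => f w ^+ 2)).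

Lemma square_integrableM f g : square_integrable f -> square_integrable g ->
  P.-integrable setT (EFin \o (fun w => f w * g w)).
Proof.
move=> [mf intf] [mg intg].
apply: (@le_integrabler _ _ _ _ _ _ (fun w => f w ^+ 2 + g w ^+ 2)) => //.
- exact: measurable_funM.
- move=> w _; rewrite ler_norml.
  by apply/andP; split; nra.
- exact: integrable_addr.
Qed.

Lemma square_integrable_cst (c : R) : square_integrable (fun _ => c).
Proof. by split; [exact: measurable_cst|exact: finite_measure_integrable_cst].
  Qed.

Lemma square_integrable1 f : square_integrable f ->
  P.-integrable setT (EFin \o f).
Proof.
move=> sf; have := square_integrableM sf (square_integrable_cst 1).
by under eq_fun do rewrite mulr1.
Qed.

Lemma square_integrableD f g : square_integrable f -> square_integrable g ->
  square_integrable (fun w => f w + g w).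
Proof.
move=> sf sg; have [[mf intf] [mg intg]] := (sf, sg); split.
  exact: measurable_funD.
rewrite (_ : (fun w => _) =
    (fun w => f w ^+ 2 + (2 * (f w * g w) + g w ^+ 2))); last first.
  by apply/funext => w; lra.
apply: integrable_addr => //; apply: integrable_addr => //.
exact/integrable_mulrl/square_integrableM.
Qed.

Lemma square_integrable_sum (I : Type) (s : seq I) (F : I -> T -> R)
    (p : pred I) : (forall i, square_integrable (F i)) ->
  square_integrable (fun w => \sum_(i <- s | p i) F i w).
Proof.
move=> sF; elim: s => [|i s IHs].
  under eq_fun do rewrite big_nil; exact: square_integrable_cst.
under eq_fun do rewrite big_cons.
by case: (p i) => //; exact: square_integrableD.
Qed.

Lemma le_square_integrable f g : measurable_fun setT f -> square_integrable g ->
  (forall w, `|f w| <= g w) -> square_integrable f.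
Proof.
move=> mf [mg intg] fg; split => //.
apply: (@le_integrabler _ _ _ _ _ _ (fun w => g w ^+ 2)) => //.
  exact: measurable_funX.
move=> w _; rewrite ger0_norm ?sqr_ge0// -real_normK ?num_real//.
by rewrite lerXn2r// ?nnegrE// (le_trans _ (fg w)).
Qed.

Lemma square_integrable_norm f : square_integrable f ->
  square_integrable (fun w => `|f w|).
Proof.
move=> [mf intf]; split; first exact: measurableT_comp.
by under eq_fun do rewrite real_normK ?num_real//.
Qed.

End square_integrable.

(** * The random kernel *)

Section local_dependence.
Context d (T : measurableType d) (R : realType) (P : probability T R).
Context (J : finType) (X : J -> {RV P >-> R}) (A : J -> {set J}).
Local Notation mu := (@lebesgue_measure R).
Local Notation W := (total_sum X).
Local Notation Y := (neighborhood_sum X A).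
Local Notation Khat := (Khat X A).
Hypothesis X_sq : forall i, square_integrable P (X i).

Lemma total_sum_sq : square_integrable P W.
Proof. exact: square_integrable_sum. Qed.

Lemma neighborhood_sum_sq i : square_integrable P (Y i).
Proof. exact: square_integrable_sum. Qed.

Let mX i : measurable_fun setT (X i).
Proof. by have [] := X_sq i. Qed.


Let mY i : measurable_fun setT (Y i).
Proof. by have [] := neighborhood_sum_sq i. Qed.


Let mX1 i : measurable_fun setT (fun z : T * R => X i z.1).
Proof. exact: (measurableT_comp (mX i) measurable_fst). Qed.

Let mkY i : measurable_fun setT (fun z : T * R => kern (Y i z.1) z.2).
Proof.
apply: measurable_kern; last exact: measurable_snd.
exact: (measurableT_comp (mY i) measurable_fst).
Qed.

(** A square integrable bound of [Khat t], uniform in [t]. *)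
Definition abs_sum (w : T) : R := \sum_i `|X i w|.

Lemma abs_sum_sq : square_integrable P abs_sum.
Proof. by apply: square_integrable_sum => i; exact: square_integrable_norm. Qed.

Lemma KhatE t w : Khat t w = \sum_i X i w * kern (Y i w) t.
Proof. by []. Qed.

Lemma norm_Khat_le t w : `|Khat t w| <= abs_sum w.
Proof.
rewrite KhatE (le_trans (ler_norm_sum _ _ _))// ler_sum// => i _.
by rewrite normrM ler_piMr// norm_kern_le1.
Qed.

Lemma measurable_Khat2 : measurable_fun setT (fun z : T * R => Khat z.2 z.1).
Proof.
by apply: measurable_sum => i; exact: (measurable_funM (mX1 i) (mkY i)).
Qed.

Lemma measurable_Khat t : measurable_fun setT (Khat t).
Proof. exact: (@measurable_fun_pair1 _ _ _ _ _ _
  (fun z : T * R => Khat z.2 z.1) t measurable_Khat2). Qed.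

Lemma Khat_sq t : square_integrable P (Khat t).
Proof.
by apply: le_square_integrable abs_sum_sq (norm_Khat_le t);
  exact: measurable_Khat.
Qed.

Lemma Fubini_kern i (G : T * R -> R) (M : R) : measurable_fun setT G ->
  (forall z, `|G z| <= M) ->
  [/\ \int[P]_w (X i w * \int[mu]_(t in window) (G (w, t) * kern (Y i w) t)) =
      \int[mu]_(t in window) \int[P]_w (G (w, t) * (X i w * kern (Y i w) t)),
      mu.-integrable window
        (EFin \o (fun t => \int[P]_w (G (w, t) * (X i w * kern (Y i w) t)))) &
      P.-integrable setT (EFin \o (fun w =>
        X i w * \int[mu]_(t in window) (G (w, t) * kern (Y i w) t)))].
Proof.
move=> mG GM.
have inner w : \int[mu]_(t in window) (G (w, t) * (X i w * kern (Y i w) t)) =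
    X i w * \int[mu]_(t in window) (G (w, t) * kern (Y i w) t).
  rewrite -RintegralZl//; [|exact: measurable_window|].
    by apply: eq_Rintegral => t _; rewrite mulrCA.
  apply: (@bounded_integrabler _ _ _ _ _ _ M).
  - exact: measurable_window.
  - by rewrite [X in (X < _)%E]lebesgue_window ltry.
  - apply: measurable_funTS.
    apply: (@measurable_fun_pair2 _ _ _ _ _ _
      (fun z => G z * kern (Y i z.1) z.2)).
    exact: measurable_funM.
  - move=> t _; rewrite normrM -[M]mulr1 ler_pM//.
    exact: norm_kern_le1.
have mG' : measurable_fun setT
    (fun z : T * R => G z * (X i z.1 * kern (Y i z.1) z.2)).
  by apply: measurable_funM => //; exact: (measurable_funM (mX1 i) (mkY i)).
have intS : P.-integrable setT (EFin \o (fun w => M * `|X i w|)).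
  apply: integrable_mulrl => //; apply: integrable_normr => //.
  exact/square_integrable1.
have window_fin : (mu window < +oo)%E by rewrite lebesgue_window ltry.
have [] := Fubini_dominated (@measurable_window R) window_fin mG' intS.
  move=> w t _ /=; rewrite normrM ler_pM// normrM ler_piMr//.
  exact: norm_kern_le1.
move=> E1 E2 E3.
split.
- by under eq_Rintegral do rewrite -inner.
- exact: E2.
- by under eq_fun do rewrite -inner.
Qed.

Lemma Fubini_Khat (G : T * R -> R) (M : R) : measurable_fun setT G ->
  (forall z, `|G z| <= M) ->
  \sum_i \int[P]_w (X i w * \int[mu]_(t in window) (G (w, t) * kern (Y i w) t))
    =
  \int[mu]_(t in window) \int[P]_w (G (w, t) * Khat t w) /\
  mu.-integrable window (EFin \o (fun t => \int[P]_w (G (w, t) * Khat t w))).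
Proof.
move=> mG GM.
have intGX i t :
    P.-integrable setT (EFin \o (fun w => G (w, t) * (X i w * kern (Y i w) t))).
  apply: (@le_integrable_mul_bounded _ _ _ _ _ _ _ M) => //.
    exact: measurable_fun_pair1.
  have := @square_integrable1 _ _ _ P (fun w => X i w * kern (Y i w) t); apply.
  apply: (@le_square_integrable _ _ _ P _ (fun w => `|X i w|)).
  - apply: measurable_funM => //; apply: measurable_kern => //.
  - exact: square_integrable_norm.
  - by move=> w; rewrite normrM ler_piMr// norm_kern_le1.
have sumE t : \int[P]_w (G (w, t) * Khat t w) =
    \sum_i \int[P]_w (G (w, t) * (X i w * kern (Y i w) t)).
  rewrite -Rintegral_sum//; apply: eq_Rintegral => w _.
  by rewrite KhatE mulr_sumr.
split.
  under [in RHS]eq_Rintegral do rewrite sumE.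
  rewrite Rintegral_sum; [|exact: measurable_window|].
    by apply: eq_bigr => i _; have [] := Fubini_kern i mG GM.
  by move=> i; have [] := Fubini_kern i mG GM.
under eq_fun do rewrite sumE.
apply: integrable_sumr; first exact: measurable_window.
by move=> i; have [] := Fubini_kern i mG GM.
Qed.

End local_dependence.

(** * Mean increments of a ramp *)

Section smoothing.
Context d (T : measurableType d) (R : realType) (P : probability T R).
Local Notation mu := (@lebesgue_measure R).

Lemma measurable_Rintegral_ge0 (G : T * R -> R) : measurable_fun setT G ->
  (forall z, 0 <= G z) ->
  measurable_fun setT (fun t => \int[P]_w G (w, t)).
Proof.
move=> mG G0; apply: measurableT_comp => //.
apply: (@measurable_fun_fubini_tonelli_G _ _ _ _ _ P (EFin \o G)).
  exact/measurable_EFinP.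
by move=> z; rewrite lee_fin.
Qed.

Lemma probability_bounded_integrable (f : T -> R) (M : R) :
  measurable_fun setT f -> (forall w, `|f w| <= M) ->
  P.-integrable setT (EFin \o f).
Proof.
move=> mf fM; apply: (@bounded_integrabler _ _ _ _ _ _ M) => //.
exact: (le_lt_trans (probability_le1 P measurableT) (ltry 1)).
Qed.

Lemma Rintegral_probability_cst (c : R) : \int[P]_w c = c.
Proof. by rewrite Rintegral_cst// [X in fine X]probability_setT mulr1. Qed.

Definition itv_prob (Z : T -> R) (a b : R) : R :=
  \int[P]_w (a <= Z w <= b)%R%:R.

Context (Z : T -> R) (mZ : measurable_fun setT Z).

Let mZ1 : measurable_fun setT (fun z : T * R => Z z.1).
Proof. exact: (measurableT_comp mZ measurable_fst). Qed.

Lemma measurable_itv_bool a b :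
  measurable_fun setT (fun w => (a <= Z w <= b)%R%:R : R).
Proof.
apply: measurable_natr_bool; apply: measurable_and;
  apply: measurable_fun_ler => //.
Qed.

Lemma integrable_itv_bool a b :
  P.-integrable setT (EFin \o (fun w => (a <= Z w <= b)%R%:R)).
Proof.
apply: (@probability_bounded_integrable _ 1); first exact: measurable_itv_bool.
by move=> w; rewrite ger0_norm//; case: (_ <= _ <= _).
Qed.

Lemma itv_prob_le1 a b : itv_prob Z a b <= 1.
Proof.
rewrite -[leRHS]Rintegral_probability_cst; apply: le_Rintegral => //.
- exact: integrable_itv_bool.
- exact: finite_measure_integrable_cst.
- by move=> w _; case: (_ <= _ <= _).
Qed.

Lemma measurable_ramp_shift l c :
  measurable_fun setT (fun z : T * R => ramp l (Z z.1 + z.2 - c)).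
Proof.
apply: (measurableT_comp (measurable_ramp l)).
by apply: measurable_funB => //; apply: measurable_funD.
Qed.

Lemma integrable_ramp_shift l c :
  P.-integrable setT (EFin \o (fun w => ramp l (Z w - c))).
Proof.
apply: (@probability_bounded_integrable _ 1).
  apply: (measurableT_comp (measurable_ramp l)).
  exact: measurable_funB.
by move=> w; rewrite ger0_norm ?ramp_ge0// ramp_le1.
Qed.

Definition ramp_mean l c : R := \int[P]_w ramp l (Z w - c).

(** The increment of a ramp is the average of indicators of intervals of length
    [l] ([ramp_increment]); the expectation is taken under the integral. *)
Lemma ramp_mean_increment l (dlt c t : R) : 0 < l -> 0 <= t ->
  (forall x, itv_prob Z x (x + l) <= dlt) ->
  0 <= ramp_mean l (c - t) - ramp_mean l c <= t * (dlt / l).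
Proof.
move=> l0 t0 Zdlt; rewrite /ramp_mean -RintegralB//; last 2 first.
- exact: integrable_ramp_shift.
- exact: integrable_ramp_shift.
apply/andP; split.
  by apply: Rintegral_ge0 => w _; rewrite subr_ge0 ramp_homo//; lra.
under eq_Rintegral => w _.
  rewrite (_ : Z w - (c - t) = (Z w - c) + t); last by lra.
  rewrite ramp_increment//.
over.
have mI : measurable_fun setT
    (fun z : T * R => (0 <= Z z.1 - c + z.2 <= l)%R%:R : R).
  apply: measurable_natr_bool; apply: measurable_and;
    apply: measurable_fun_ler => //; apply: measurable_funD;
    do ?exact: measurable_funB; exact: measurable_snd.
have Dfin : (mu `[0%R, t]%classic < +oo)%E.
  by rewrite lebesgue_measure_itv/=; case: ifP => _; rewrite ?ltry.
have int1 : P.-integrable setT (EFin \o (fun _ : T => 1)).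
  exact: finite_measure_integrable_cst.
have [] := Fubini_dominated (measurable_itv `[0%R, t]) Dfin mI int1.
  by move=> w u _; rewrite ger0_norm//; case: (_ <= _ <= _).
move=> E1 E2 E3.
rewrite RintegralZl// E1 [leRHS]mulrA [leRHS]mulrC ler_pM2l ?invr_gt0//.
have mut : fine (mu `[0%R, t]%classic) = t.
  by rewrite lebesgue_measure_itv/= lte_fin; case: ltP => [//|?] /=; lra.
rewrite -[X in X * dlt]mut mulrC -Rintegral_cst//; apply: le_Rintegral => //.
  exact: continuous_Rintegrable (continuous_cstr _).
move=> u _; apply: le_trans (Zdlt (c - u)).
apply: le_Rintegral => //.
- apply: (@probability_bounded_integrable _ 1).
    by have := @measurable_fun_pair1 _ _ _ _ _ _ _ u mI.
  by move=> w; rewrite ger0_norm//; case: (_ <= _ <= _).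
- exact: integrable_itv_bool.
move=> w _ /=; rewrite (_ : (0 <= _ <= _) = (c - u <= Z w <= c - u + l))//.
by congr andb; apply/idP/idP => ?; lra.
Qed.

(** Both increments have the sign of [t], so that the bound for a single ramp
    also holds for a difference of two ramps. *)
Lemma ramp_mean_shift2 l (dlt c1 c2 t : R) : 0 < l ->
  (forall x, itv_prob Z x (x + l) <= dlt) ->
  `|(ramp_mean l (c1 - t) - ramp_mean l c1) -
    (ramp_mean l (c2 - t) - ramp_mean l c2)| <= `|t| * (dlt / l).
Proof.
move=> l0 Zdlt; have [t0|/ltW t0] := leP 0 t.
  have /andP[a1 a2] := ramp_mean_increment c1 l0 t0 Zdlt.
  have /andP[b1 b2] := ramp_mean_increment c2 l0 t0 Zdlt.
  by rewrite (ger0_norm t0) ler_norml; apply/andP; split; lra.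
have t0' : 0 <= - t by rewrite oppr_ge0.
have /andP[a1 a2] := ramp_mean_increment (c1 - t) l0 t0' Zdlt.
have /andP[b1 b2] := ramp_mean_increment (c2 - t) l0 t0' Zdlt.
rewrite !opprK !subrK in a1 a2 b1 b2.
by rewrite (ler0_norm t0) ler_norml; apply/andP; split; lra.
Qed.

Lemma Rintegral_norm_ramp_increment l (dlt c t : R) : 0 < l ->
  (forall x, itv_prob Z x (x + l) <= dlt) ->
  \int[P]_w `|ramp l (Z w + t - c) - ramp l (Z w - c)| <= `|t| * (dlt / l).
Proof.
move=> l0 Zdlt.
have shiftE w : Z w + t - c = Z w - (c - t) by lra.
have [t0|/ltW t0] := leP 0 t.
  have /andP[_] := ramp_mean_increment c l0 t0 Zdlt.
  rewrite (ger0_norm t0); apply: le_trans; rewrite /ramp_mean -RintegralB//;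
    [|exact: integrable_ramp_shift|exact: integrable_ramp_shift].
  rewrite le_eqVlt; apply/orP; left; apply/eqP; apply: eq_Rintegral => w _.
  by rewrite shiftE ger0_norm// subr_ge0 ramp_homo//; lra.
have t0' : 0 <= - t by rewrite oppr_ge0.
have /andP[_] := ramp_mean_increment (c - t) l0 t0' Zdlt.
rewrite (ler0_norm t0); apply: le_trans.
rewrite opprK subrK /ramp_mean -RintegralB//;
  [|exact: integrable_ramp_shift|exact: integrable_ramp_shift].
rewrite le_eqVlt; apply/orP; left; apply/eqP; apply: eq_Rintegral => w _.
by rewrite shiftE ler0_norm ?opprB// subr_le0 ramp_homo//; lra.
Qed.

End smoothing.

(** * Expansions along the kernel *)

Section stein_expansion.
Context d (T : measurableType d) (R : realType) (P : probability T R).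
Context (J : finType) (X : J -> {RV P >-> R}) (A : J -> {set J}).
Local Notation mu := (@lebesgue_measure R).
Local Notation W := (total_sum X).
Local Notation Y := (neighborhood_sum X A).
Local Notation Khat := (Khat X A).
Hypothesis X_sq : forall i, square_integrable P (X i).

Let W_sq : square_integrable P W := total_sum_sq X_sq.
Let Y_sq i : square_integrable P (Y i) := neighborhood_sum_sq A X_sq i.
Let mW : measurable_fun setT W := W_sq.1.
Let mY i : measurable_fun setT (Y i) := (Y_sq i).1.
Let mW1 : measurable_fun setT (fun z : T * R => W z.1).
Proof. exact: (measurableT_comp mW measurable_fst). Qed.

(** Real counterparts of the error terms: [tail_term] is [r2], [kernel_moment]
    is [r3] for the weight 1 and [r4] for the weight [W], [total_var] is [r5],
    and [weighted_var] is the square of [r6]. *)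
Definition tail_term : R :=
  \sum_i \int[P]_w (`|X i w * Y i w| * (1 < `|Y i w|)%R%:R).

Definition kernel_moment (u : T -> R) : R :=
  \sum_i \int[P]_w (`|u w * X i w| * Num.min (Y i w ^+ 2) 1).

Definition Khat_mean (t : R) : R := \int[P]_w Khat t w.

Definition Khat_var (t : R) : R := \int[P]_w (Khat t w - Khat_mean t) ^+ 2.

Definition total_var : R := \int[mu]_(t in window) Khat_var t.

Definition weighted_var : R := \int[mu]_(t in window) (`|t| * Khat_var t).

Let window_fin : (mu window < +oo)%E.
Proof. by rewrite lebesgue_window ltry. Qed.

Lemma window_bounded_integrable (q : R -> R) (M : R) :
  measurable_fun setT q -> (forall t, window t -> `|q t| <= M) ->
  mu.-integrable window (EFin \o q).
Proof.
move=> mq qM; apply: (@bounded_integrabler _ _ _ _ _ _ M) => //.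
- exact: measurable_window.
- exact: measurable_funTS.
Qed.

Lemma norm_sub_clip1 (y : R) : `|y - clip1 y| <= `|y| * (1 < `|y|)%R%:R.
Proof.
case: clip1P => [y1|y1 y2|y1].
- rewrite ler0_norm; last by lra.
  have [y2|y2] := ltP 1 `|y|; first by rewrite mulr1 ler0_norm; lra.
  by rewrite mulr0; move: y2; rewrite ler0_norm; lra.
- by rewrite subrr normr0 mulr_ge0.
- rewrite ger0_norm; last by lra.
  have [y2|y2] := ltP 1 `|y|; first by rewrite mulr1 ger0_norm; lra.
  by rewrite mulr0; move: y2; rewrite ger0_norm; lra.
Qed.

Let mtail i : measurable_fun setT
  (fun w => `|X i w * Y i w| * (1 < `|Y i w|)%R%:R).
Proof.
apply: measurable_funM.
  by apply: measurableT_comp => //; exact: measurable_funM.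
by apply: measurable_natr_bool; apply: measurable_fun_ltr => //;
  exact: measurableT_comp.
Qed.

Lemma integrable_tail_term i : P.-integrable setT
  (EFin \o (fun w => `|X i w * Y i w| * (1 < `|Y i w|)%R%:R)).
Proof.
apply: (@le_integrabler _ _ _ _ _ _ (fun w => `|X i w * Y i w|)) => //.
- by move=> w _; rewrite normrM normr_id ler_piMr//; case: (_ < _) => /=;
    rewrite ?normr1 ?normr0.
- exact/integrable_normr/square_integrableM.
Qed.

Lemma tail_term_ge0 : 0 <= tail_term.
Proof.
by apply: sumr_ge0 => i _; apply: Rintegral_ge0 => w _; rewrite mulr_ge0.
Qed.

(** Replacing [Y i] by its truncation to [[-1, 1]] costs [tail_term]. *)
Lemma le_tail_term (V : J -> T -> R) : (forall i, measurable_fun setT (V i)) ->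
  (forall i w, `|V i w| <= `|Y i w - clip1 (Y i w)|) ->
  (forall i, P.-integrable setT (EFin \o (fun w => X i w * V i w))) /\
  `|\sum_i \int[P]_w (X i w * V i w)| <= tail_term.
Proof.
move=> mV VY.
have le i w : `|X i w * V i w| <= `|X i w * Y i w| * (1 < `|Y i w|)%R%:R.
  rewrite !normrM -mulrA ler_wpM2l// (le_trans (VY i w))//.
  exact: norm_sub_clip1.
have mXV i : measurable_fun setT (fun w => X i w * V i w).
  exact: measurable_funM.
split=> [i|].
  exact: (le_integrabler measurableT (mXV i) (fun w _ => le i w)
    (integrable_tail_term i)).
rewrite (le_trans (ler_norm_sum _ _ _))// ler_sum// => i _.
by apply: le_norm_Rintegral => //; exact: integrable_tail_term.
Qed.

Lemma measurable_clip1 : measurable_fun setT (@clip1 R).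
Proof.
have m1 : measurable_fun setT (id \min (fun _ : R => 1)).
  by apply: measurable_minr; [exact: measurable_id|exact: measurable_cst].
exact: (measurable_maxr (@measurable_cst _ _ R R setT (-1)) m1).
Qed.

(** For [u = 1]: the mean kernel on [|t| <= 1] has almost all of the mass
    [sum_i E (X i * Y i)]. *)
Lemma window_constant (u : T -> R) : measurable_fun setT u ->
  (forall w, `|u w| <= 1) ->
  `|\sum_i \int[P]_w (X i w * (u w * Y i w)) -
    \int[mu]_(t in window) \int[P]_w (u w * Khat t w)| <= tail_term.
Proof.
move=> mu_ u1.
have mG : measurable_fun setT (fun z : T * R => u z.1).
  exact: (measurableT_comp mu_ measurable_fst).
have [E _] := Fubini_Khat A X_sq mG (fun z => u1 z.1).
rewrite -E/= -sumrB.
have clipE i w : \int[mu]_(t in window) (u w * kern (Y i w) t) =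
    u w * clip1 (Y i w).
  rewrite RintegralZl ?Rintegral_kern1//; first exact: measurable_window.
  apply: (@window_bounded_integrable _ 1) => [|t _]; last exact: norm_kern_le1.
  by apply: measurable_kern => //; exact: measurable_cst.
have intXu i (V : T -> R) : square_integrable P V ->
    P.-integrable setT (EFin \o (fun w => X i w * (u w * V w))).
  move=> sV; under eq_fun do rewrite mulrCA.
  apply: (@le_integrable_mul_bounded _ _ _ _ _ _ _ 1) => //.
  exact: square_integrableM.
have mc i : measurable_fun setT (fun w => clip1 (Y i w)).
  exact: (measurableT_comp measurable_clip1).
have c_sq i : square_integrable P (fun w => clip1 (Y i w)).
  apply: (le_square_integrable (mc i) (square_integrable_cst P 1)) => w.
  by case: clip1P => *; rewrite ler_norml; apply/andP; split; lra.
under eq_bigr => i _.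
  under [X in _ - X]eq_Rintegral do rewrite clipE.
  rewrite -RintegralB//; [|exact: intXu|exact: intXu].
  under eq_Rintegral do rewrite -!mulrBr.
over.
apply: (le_tail_term _ _).2 => [i|i w].
  by apply: measurable_funM => //; exact: measurable_funB.
by rewrite normrM ler_piMl.
Qed.

(** By [Rintegral_kern] the integral over [|t| <= 1] is the increment of [f]
    from [W - clip1 (Y i)] to [W]; what is left is an increment of [f] over a
    distance [|Y i - clip1 (Y i)|]. *)
Lemma window_derivative (f q : R -> R) : continuous q ->
  (forall x : R, is_derive x 1 f (q x)) -> (forall x, `|q x| <= 1) ->
  `|\sum_i \int[P]_w (X i w * (f (W w) - f (W w - Y i w))) -
    \int[mu]_(t in window) \int[P]_w (q (W w + t) * Khat t w)| <= tail_term.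
Proof.
move=> cq df q1.
have mq : measurable_fun setT q by exact: continuous_measurable_fun.
have mf : measurable_fun setT f.
  by apply: continuous_measurable_fun; exact: (is_derive_continuous df).
have mG : measurable_fun setT (fun z : T * R => q (W z.1 + z.2)).
  apply: (measurableT_comp mq); apply: measurable_funD => //.
have [E _] := Fubini_Khat A X_sq mG (fun z => q1 _).
rewrite -E/= -sumrB.
have mc i : measurable_fun setT (fun w => clip1 (Y i w)).
  exact: (measurableT_comp measurable_clip1).
have kernE i w : \int[mu]_(t in window) (q (W w + t) * kern (Y i w) t) =
    f (W w) - f (W w - clip1 (Y i w)).
  have dQ (t : R) : is_derive t 1 (fun t => f (t + W w)) (q (W w + t)).
    by apply: is_derive_shiftl; rewrite addrC.
  rewrite (Rintegral_kern _ dQ) ?add0r ?[- _ + _]addrC//.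
  move=> t; apply: (@continuous_comp _ _ _ (fun t : R => W w + t) q).
    by apply: continuousD; [exact: cst_continuous|exact: cvg_id].
  exact: cq.
have flip x y : `|f x - f y| <= `|x - y|.
  by have := lipschitz_derivative df q1 y x; rewrite mul1r.
have mfc i (V : T -> R) : measurable_fun setT V ->
    measurable_fun setT (fun w => f (W w) - f (W w - V w)).
  move=> mV; apply: measurable_funB; apply: (measurableT_comp mf) => //.
  exact: measurable_funB.
have intXf i (V : T -> R) : square_integrable P V ->
    P.-integrable setT (EFin \o (fun w => X i w * (f (W w) - f (W w - V w)))).
  move=> sV; apply: square_integrableM => //.
  apply: (le_square_integrable _ (square_integrable_norm sV)).
    by apply: mfc => //; have [] := sV.
  by move=> w; rewrite (le_trans (flip _ _))// opprB addrC subrK.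
have c_sq i : square_integrable P (fun w => clip1 (Y i w)).
  apply: (le_square_integrable (mc i) (square_integrable_cst P 1)) => w.
  by case: clip1P => *; rewrite ler_norml; apply/andP; split; lra.
under eq_bigr => i _.
  under [X in _ - X]eq_Rintegral do rewrite kernE.
  rewrite -RintegralB//; [|exact: intXf|exact: intXf].
  under eq_Rintegral do rewrite -mulrBr.
over.
apply: (le_tail_term _ _).2 => [i|i w].
  by apply: measurable_funB; exact: mfc.
rewrite (_ : _ - _ = f (W w - clip1 (Y i w)) - f (W w - Y i w)); last by lra.
rewrite (le_trans (flip _ _))//.
by rewrite (_ : _ - _ = Y i w - clip1 (Y i w)); last by lra.
Qed.

End stein_expansion.

(** * Trapezoids *)

Section trapezoid.
Context (R : realType).
Local Notation mu := (@lebesgue_measure R).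
Variables (a b l : R).
Hypotheses (ab : a <= b) (l0 : 0 < l).

Definition trapezoid (x : R) : R := ramp l (x - (a - l)) - ramp l (x - b).

Lemma continuous_trapezoid : continuous trapezoid.
Proof.
exact: continuous_subr (continuous_ramp_shift _ _) (continuous_ramp_shift _ _).
Qed.

Lemma trapezoid_ge0 x : 0 <= trapezoid x.
Proof. by rewrite subr_ge0 ramp_homo//; move: ab l0; lra. Qed.

Lemma trapezoid_le1 x : trapezoid x <= 1.
Proof.
rewrite /trapezoid; have := ramp_le1 l (x - (a - l)).
by have := ramp_ge0 l (x - b); lra.
Qed.

Lemma trapezoid_mid x : a <= x <= b -> trapezoid x = 1.
Proof.
move=> /andP[ax xb]; rewrite /trapezoid ramp_high//; last by move: ab l0; lra.
by rewrite ramp_low ?subr0//; move: ab l0; lra.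
Qed.

Lemma trapezoid_out x : x \notin `[a - l, b + l] -> trapezoid x = 0.
Proof.
rewrite in_itv/= negb_and -!ltNge => /orP[?|?]; rewrite /trapezoid.
  by rewrite !ramp_low ?subrr//; move: ab l0; lra.
by rewrite !ramp_high ?subrr//; move: ab l0; lra.
Qed.

Lemma integrable_trapezoid : mu.-integrable setT (EFin \o trapezoid).
Proof.
rewrite (_ : trapezoid = trapezoid \_ `[a - l, b + l]).
  rewrite -restrict_EFin; apply/integrable_restrict => //.
  by rewrite setTI; apply: continuous_Rintegrable; exact: continuous_trapezoid.
by apply/funext => x; rewrite patchE mem_setE; case: ifPn => // /trapezoid_out.
Qed.

(** The offset is half of [b - a + 2 l],
    which bounds the area of the trapezoid. *)
Definition trapezoid_primitive (x : R) : R :=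
  \int[mu]_(t in `]-oo, x]) trapezoid t - ((b - a) / 2 + l).

Lemma is_derive_trapezoid_primitive (x : R) :
  is_derive x 1 trapezoid_primitive (trapezoid x).
Proof.
rewrite -[X in is_derive _ _ _ X]subr0; apply: is_derive_subr.
  apply: is_derive_Rintegral_Ny; first exact: integrable_trapezoid.
  exact: continuous_trapezoid.
Qed.

Lemma norm_trapezoid_primitive_le x : `|trapezoid_primitive x| <= (b - a)
  / 2 + l.
Proof.
rewrite /trapezoid_primitive; set I := Rintegral _ _ _.
have I0 : 0 <= I by apply: Rintegral_ge0 => t _; exact: trapezoid_ge0.
have itv_len : fine (mu `[a - l, b + l]%classic) = b - a + 2 * l.
  by rewrite lebesgue_measure_itv/= lte_fin ifT /=; move: ab l0; lra.
have I1 : I <= b - a + 2 * l.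
  rewrite -itv_len -[leRHS]mul1r -Rintegral_cst// /I.
  rewrite Rintegral_mkcond [leRHS]Rintegral_mkcond; apply: le_Rintegral => //.
  - rewrite -restrict_EFin; apply/integrable_restrict => //.
    by rewrite setTI; exact: integrableS integrable_trapezoid.
  - rewrite -restrict_EFin; apply/integrable_restrict => //.
    by rewrite setTI; exact: continuous_Rintegrable (continuous_cstr _).
  - move=> t _; rewrite !patchE; case: ifPn => _; case: ifPn => // t1.
      exact: trapezoid_le1.
    by rewrite trapezoid_out//; apply: contra t1; rewrite mem_setE.
by rewrite ler_norml; apply/andP; split; move: ab l0; lra.
Qed.

Lemma Rintegral_trapezoid_sqr w :
  \int[mu]_(t in window) (trapezoid (w + t) ^+ 2) <= b - a + 2 * l.
Proof.
have itv_len : fine (mu `[a - l - w, b + l - w]%classic) = b - a + 2 * l.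
  by rewrite lebesgue_measure_itv/= lte_fin ifT /=; move: ab l0; lra.
rewrite -itv_len -[leRHS]mul1r -Rintegral_cst//.
rewrite Rintegral_mkcond [leRHS]Rintegral_mkcond; apply: le_Rintegral => //.
- rewrite -restrict_EFin; apply/integrable_restrict => //.
    exact: measurable_window.
  rewrite setTI; apply: (@window_bounded_integrable _ _ 1).
    apply: measurable_funX; apply: continuous_measurable_fun.
    move=> t; apply: (@continuous_comp _ _ _ (fun t : R => w + t) trapezoid).
      by apply: continuousD; [exact: cst_continuous|exact: cvg_id].
    exact: continuous_trapezoid.
  move=> t _; rewrite ger0_norm ?sqr_ge0// expr_le1// ?trapezoid_ge0//.
  exact: trapezoid_le1.
- rewrite -restrict_EFin; apply/integrable_restrict => //.
  by rewrite setTI; exact: continuous_Rintegrable (continuous_cstr _).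
- move=> t _; rewrite !patchE; case: ifPn => _; case: ifPn => // tab.
    by rewrite expr_le1// ?trapezoid_ge0// trapezoid_le1.
  rewrite trapezoid_out ?expr0n//=; apply: contra tab.
  by rewrite mem_setE !in_itv/= => /andP[? ?]; apply/andP; split; lra.
Qed.

End trapezoid.
Arguments continuous_trapezoid {R} a b l.

(** * Moments of the random kernel *)

Section kernel_moments.
Context d (T : measurableType d) (R : realType) (P : probability T R).
Context (J : finType) (X : J -> {RV P >-> R}) (A : J -> {set J}).
Local Notation mu := (@lebesgue_measure R).
Local Notation W := (total_sum X).
Local Notation Y := (neighborhood_sum X A).
Local Notation Khat := (Khat X A).
Local Notation Khat_mean := (Khat_mean X A).
Local Notation Khat_var := (Khat_var X A).
Hypothesis X_sq : forall i, square_integrable P (X i).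

Let Y_sq i : square_integrable P (Y i) := neighborhood_sum_sq A X_sq i.
Let mY i : measurable_fun setT (Y i) := (Y_sq i).1.
Let window_fin : (mu window < +oo)%E.
Proof. by rewrite lebesgue_window ltry. Qed.

Lemma integrable_kernel_moment (u : T -> R) i : square_integrable P u ->
  P.-integrable setT
    (EFin \o (fun w => `|u w * X i w| * Num.min (Y i w ^+ 2) 1)).
Proof.
move=> sq_u.
apply: (@le_integrabler _ _ _ _ _ _ (fun w => `|u w * X i w|)) => //.
- apply: measurable_funM.
    by apply: measurableT_comp => //; apply: measurable_funM => //;
      exact: sq_u.1.
  apply: (@measurable_minr _ _ _ _ (fun w => Y i w ^+ 2) (fun=> 1)) => //.
  exact: measurable_funX.
- move=> w _; rewrite normrM normr_id ler_piMr// ger0_norm ?le_min ?sqr_ge0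
  ?ler01//.
  by rewrite ge_min lexx orbT.
- exact/integrable_normr/square_integrableM.
Qed.

(** The factor [|t|] is integrated against [kern (Y i) t], whose first absolute
    moment on [|t| <= 1] is half of the minimum of [Y i ^ 2] and 1. *)
Lemma window_dominated (G : T * R -> R) (M : R) (u : T -> R) :
  measurable_fun setT G -> (forall z, `|G z| <= M) ->
  square_integrable P u ->
  (forall w t, window t -> `|G (w, t)| <= u w * `|t|) ->
  `|\int[mu]_(t in window) \int[P]_w (G (w, t) * Khat t w)| <=
  2^-1 * kernel_moment X A u.
Proof.
move=> mG GM sq_u Gu.
have [<- _] := Fubini_Khat A X_sq mG GM.
rewrite (le_trans (ler_norm_sum _ _ _))// mulr_sumr ler_sum// => i _.
rewrite -RintegralZl//; last exact: integrable_kernel_moment.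
have [_ _ int_i] := Fubini_kern A X_sq i mG GM.
apply: le_norm_Rintegral => //.
- exact: integrable_measurable int_i.
- move=> w _; rewrite normrM.
  have mk : measurable_fun setT (fun t => kern (Y i w) t).
    by apply: measurable_kern => //; exact: measurable_cst.
  have u0 : 0 <= u w.
    by have := Gu w 1; rewrite /window /= normr1 mulr1 => /(_ (lexx _));
      apply: le_trans.
  apply: (@le_trans _ _ (`|X i w| *
      \int[mu]_(t in window) (u w * (`|t| * `|kern (Y i w) t|)))).
    rewrite ler_wpM2l//; apply: le_norm_Rintegral.
    + exact: measurable_window.
    + apply: measurable_funTS; apply: measurable_funM => //.
      exact: measurable_fun_pair2.
    + by move=> t wt; rewrite normrM mulrA ler_wpM2r// Gu.
    + apply: integrable_mulrl; first exact: measurable_window.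
      apply: (@window_bounded_integrable _ _ 1).
        by apply: measurable_funM => //; exact: measurableT_comp.
      by move=> t wt; rewrite normrM !normr_id mulr_ile1// norm_kern_le1.
  rewrite RintegralZl ?Rintegral_normM_kern//; [|exact: measurable_window|].
    rewrite normrM (ger0_norm u0) le_eqVlt; apply/orP; left; apply/eqP; ring.
  apply: (@window_bounded_integrable _ _ 1).
    by apply: measurable_funM => //; exact: measurableT_comp.
  by move=> t wt; rewrite normrM !normr_id mulr_ile1// norm_kern_le1.
- by apply: integrable_mulrl => //; exact: integrable_kernel_moment.
Qed.

Lemma integrable_Khat_mean : mu.-integrable window (EFin \o Khat_mean).
Proof.
have m1 : measurable_fun setT (fun _ : T * R => 1 : R) by exact: measurable_cst.
have b1 (z : T * R) : `|1 : R| <= 1 by rewrite normr1.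
have [_] := Fubini_Khat A X_sq m1 b1.
by apply: eq_integrable => [|t _ /=]; [exact: measurable_window|
  congr EFin; apply: eq_Rintegral => w _; rewrite mul1r].
Qed.

Lemma Khat_centered_sq t :
  square_integrable P (fun w => Khat t w - Khat_mean t).
Proof.
have := square_integrableD (Khat_sq A X_sq t)
  (square_integrable_cst P (- Khat_mean t)).
by [].
Qed.

Lemma Khat_varE t : Khat_var t = \int[P]_w (Khat t w ^+ 2) - Khat_mean t ^+ 2.
Proof.
have sK := Khat_sq A X_sq t; have iK := square_integrable1 sK.
rewrite /Khat_var.
transitivity (\int[P]_w (Khat t w ^+ 2 -
    (2 * Khat_mean t * Khat t w - Khat_mean t ^+ 2))).
  by apply: eq_Rintegral => w _; lra.
have i1 : P.-integrable setT (EFin \o (fun w => 2 * Khat_mean t * Khat t w)).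
  exact: integrable_mulrl.
have i2 : P.-integrable setT (EFin \o (fun _ : T => Khat_mean t ^+ 2)).
  exact: finite_measure_integrable_cst.
rewrite RintegralB//; [|exact: sK.2|exact: integrable_subr].
rewrite RintegralB// RintegralZl// Rintegral_probability_cst -/(Khat_mean t).
by rewrite /Defs.Khat; lra.
Qed.

Lemma Khat_var_ge0 t : 0 <= Khat_var t.
Proof. by apply: Rintegral_ge0 => w _; exact: sqr_ge0. Qed.

Lemma Khat_var_le t : Khat_var t <= \int[P]_w (abs_sum X w ^+ 2).
Proof.
rewrite Khat_varE (le_trans (_ : _ <= \int[P]_w (Khat t w ^+ 2)))//.
  by rewrite gerBl sqr_ge0.
apply: le_Rintegral => //; [exact: (Khat_sq A X_sq t).2|exact: (abs_sum_sq
  X_sq).2|].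
move=> w _; rewrite -[leLHS]real_normK ?num_real//.
by rewrite lerXn2r ?nnegrE ?norm_Khat_le// (le_trans _ (norm_Khat_le X A t w)).
Qed.

Lemma measurable_Khat_var : measurable_fun window Khat_var.
Proof.
rewrite (_ : Khat_var =
    (fun t => \int[P]_w (Khat t w ^+ 2) - Khat_mean t ^+ 2)); last first.
  by apply/funext => t; exact: Khat_varE.
apply: measurable_funB.
  apply: measurable_funTS.
  apply: (@measurable_Rintegral_ge0 _ _ _ _ (fun z => Khat z.2 z.1 ^+ 2)).
    by apply: measurable_funX; exact: measurable_Khat2.
  by move=> z; exact: sqr_ge0.
by apply: measurable_funX; exact: integrable_measurable integrable_Khat_mean.
Qed.

Lemma integrable_Khat_var : mu.-integrable window (EFin \o Khat_var).
Proof.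
apply: (@bounded_integrabler _ _ _ _ _ _ (\int[P]_w (abs_sum X w ^+ 2))) => //.
- exact: measurable_window.
- exact: measurable_Khat_var.
- by move=> t _; rewrite ger0_norm ?Khat_var_ge0// Khat_var_le.
Qed.

Lemma integrable_weighted_Khat_var :
  mu.-integrable window (EFin \o (fun t => `|t| * Khat_var t)).
Proof.
apply: (@le_integrable_mul_bounded _ _ _ _ _ _ _ 1) => //.
- exact: measurable_window.
- by move=> t; rewrite normr_id.
- exact: integrable_Khat_var.
Qed.

Lemma Rintegral_mul_Khat (u : T -> R) (M t : R) : measurable_fun setT u ->
  (forall w, `|u w| <= M) ->
  \int[P]_w (u w * Khat t w) =
  \int[P]_w (u w * (Khat t w - Khat_mean t)) + Khat_mean t * \int[P]_w u w.
Proof.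
move=> mu_ uM.
have iu : P.-integrable setT (EFin \o u).
  exact: probability_bounded_integrable uM.
rewrite -RintegralZl// -RintegralD//.
- by apply: eq_Rintegral => w _; lra.
- apply: (le_integrable_mul_bounded _ _ (fun w _ => uM w)) => //.
  exact/square_integrable1/Khat_centered_sq.
- exact: integrable_mulrl.
Qed.

End kernel_moments.

(** * Concentration *)

Section stein_bounds.
Context d (T : measurableType d) (R : realType) (P : probability T R).
Context (J : finType) (X : J -> {RV P >-> R}) (A : J -> {set J}).
Local Notation mu := (@lebesgue_measure R).
Local Notation W := (total_sum X).
Local Notation Y := (neighborhood_sum X A).
Local Notation Khat := (Khat X A).
Local Notation Khat_mean := (Khat_mean X A).
Local Notation Khat_var := (Khat_var X A).
Local Notation tail_term := (tail_term X A).
Local Notation total_var := (total_var X A).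
Local Notation weighted_var := (weighted_var X A).
Local Notation third_moment := (kernel_moment X A (fun=> 1)).
Hypothesis X_sq : forall i, square_integrable P (X i).
Hypothesis stein_identity : forall (f : R -> R) (M : R), continuous f ->
  (forall x, `|f x| <= M) ->
  \int[P]_w (W w * f (W w)) =
  \sum_i \int[P]_w (X i w * (f (W w) - f (W w - Y i w))).
Hypothesis sumXY : \sum_i \int[P]_w (X i w * Y i w) = 1.
Hypothesis EW2 : \int[P]_w (W w ^+ 2) = 1.

Let W_sq : square_integrable P W := total_sum_sq X_sq.
Let mW : measurable_fun setT W := W_sq.1.
Let mW1 : measurable_fun setT (fun z : T * R => W z.1).
Proof. exact: (measurableT_comp mW measurable_fst). Qed.
Let window_fin : (mu window < +oo)%E.
Proof. by rewrite lebesgue_window ltry. Qed.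
Let mwindow : measurable (@window R) := @measurable_window R.

Lemma abs_moment_W : \int[P]_w `|W w| <= 1.
Proof.
have -> : 1 = \int[P]_w (2^-1 * (W w ^+ 2 + 1)) :> R.
  rewrite RintegralZl//; last first.
    apply: integrable_addr => //; first exact: W_sq.2.
    exact: finite_measure_integrable_cst.
  rewrite RintegralD//; [|exact: W_sq.2|exact: finite_measure_integrable_cst].
  by rewrite EW2 Rintegral_probability_cst; lra.
apply: le_Rintegral => //.
- exact/integrable_normr/square_integrable1.
- apply: integrable_mulrl => //; apply: integrable_addr => //.
    exact: W_sq.2.
  exact: finite_measure_integrable_cst.
- move=> w _; rewrite -(real_normK (num_real (W w))).
  by have := sqr_ge0 (`|W w| - 1); lra.
Qed.

Lemma kernel_moment_cst (c : R) : 0 <= c ->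
  kernel_moment X A (fun=> c) = c * third_moment.
Proof.
move=> c0; rewrite /kernel_moment mulr_sumr; apply: eq_bigr => i _.
rewrite -RintegralZl//; last first.
  exact: (integrable_kernel_moment A X_sq i (square_integrable_cst P 1)).
by apply: eq_Rintegral => w _; rewrite mul1r normrM (ger0_norm c0) mulrA.
Qed.

Lemma measurable_shift_W (q : R -> R) : measurable_fun setT q ->
  measurable_fun setT (fun z : T * R => q (W z.1 + z.2)).
Proof. by move=> mq; apply: (measurableT_comp mq); exact: measurable_funD. Qed.

Lemma Rintegral_Khat_mean : 1 - tail_term <= \int[mu]_(t in window) Khat_mean t.
Proof.
have := @window_constant _ _ _ _ _ X A X_sq (fun=> 1) (measurable_cst _).
rewrite normr1 => /(_ (fun=> lexx _)).
under [X in `|X - _|]eq_bigr do under eq_Rintegral do rewrite mul1r.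
rewrite sumXY.
under eq_Rintegral do under eq_Rintegral do rewrite mul1r.
by rewrite -/(Khat_mean _) ler_norml => /andP[_]; set I := Rintegral _ _ _; lra.
Qed.

Section concentration_at_scale.
Variables (a b l dlt : R).
Hypotheses (ab : a <= b) (l0 : 0 < l).
Hypothesis Wdlt : forall x, itv_prob P W x (x + l) <= dlt.

Local Notation g := (trapezoid a b l).
Let g_ge0 x : 0 <= g x := trapezoid_ge0 ab l0 x.
Let g_le1 x : g x <= 1 := trapezoid_le1 a b l x.
Let g_norm x : `|g x| <= 1.
Proof. by rewrite ger0_norm. Qed.
Let mg : measurable_fun setT g.
Proof. by apply: continuous_measurable_fun; exact: continuous_trapezoid. Qed.
Let mgW t : measurable_fun setT (fun w => g (W w + t)).
Proof. by apply: (measurableT_comp mg); exact: measurable_funD. Qed.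
Let igW t : P.-integrable setT (EFin \o (fun w => g (W w + t))).
Proof. exact: (probability_bounded_integrable P (mgW t)
  (fun w => g_norm _)). Qed.

Let m (t : R) : R := \int[P]_w g (W w + t).

Let mm : measurable_fun setT m.
Proof.
apply: (@measurable_Rintegral_ge0 _ _ _ P (fun z => g (W z.1 + z.2))) => //.
exact: measurable_shift_W.
Qed.

Let m_ge0 t : 0 <= m t.
Proof. by apply: Rintegral_ge0. Qed.

Let m_le1 t : m t <= 1.
Proof.
rewrite -[leRHS](Rintegral_probability_cst P); apply: le_Rintegral => //.
exact: finite_measure_integrable_cst.
Qed.

Let dlt_ge0 : 0 <= dlt / l.
Proof.
rewrite divr_ge0 ?(ltW l0)//; apply: le_trans (Wdlt 0).
by apply: Rintegral_ge0 => w _.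
Qed.

Let m_increment t : `|m t - m 0| <= `|t| * (dlt / l).
Proof.
have mE s : m s = ramp_mean P W l (a - l - s) - ramp_mean P W l (b - s).
  rewrite /m /ramp_mean -RintegralB//; [|exact: integrable_ramp_shift..].
  by apply: eq_Rintegral => w _; rewrite /trapezoid;
    congr (ramp l _ - ramp l _); lra.
have := ramp_mean_shift2 mW (a - l) b t l0 Wdlt.
by rewrite !mE !subr0; congr (`|_| <= _); lra.
Qed.

(** The weights 1/8 and 2 in Young's inequality
    [x k >= - (x^2 / 8 + 2 k^2)] fix the coefficient of [b - a] in the
    concentration inequality: 1/2 from the size of [f] and 1/8 from here. *)
Let pointwise t : m t * Khat_mean t - 8^-1 * \int[P]_w (g (W w + t) ^+ 2) -
  2 * Khat_var t <= \int[P]_w (g (W w + t) * Khat t w).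
Proof.
have sK := Khat_centered_sq A X_sq t.
have ig2 : P.-integrable setT (EFin \o (fun w => g (W w + t) ^+ 2)).
  apply: (@probability_bounded_integrable _ _ _ _ _ 1).
    exact: measurable_funX.
  by move=> w; rewrite ger0_norm ?sqr_ge0// expr_le1.
rewrite (@Rintegral_mul_Khat _ _ _ _ _ X A X_sq _ 1)// -/(m t).
suff : - (8^-1 * \int[P]_w (g (W w + t) ^+ 2) + 2 * Khat_var t) <=
    \int[P]_w (g (W w + t) * (Khat t w - Khat_mean t)) by lra.
rewrite -RintegralZl// -RintegralZl//; last exact: sK.2.
rewrite -RintegralD//; [|exact: integrable_mulrl|exact: integrable_mulrl sK.2].
rewrite -mulN1r -RintegralZl//; last first.
  apply: integrable_addr => //; first exact: integrable_mulrl.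
  exact: integrable_mulrl sK.2.
apply: le_Rintegral => //.
- apply: integrable_mulrl => //; apply: integrable_addr => //.
    exact: integrable_mulrl.
  exact: integrable_mulrl sK.2.
- apply: (le_integrable_mul_bounded _ _ (fun w _ => g_norm _)) => //.
  exact: square_integrable1.
- move=> w _; set x := g _; set k := _ - _.
  (* (x + 4 k)^2 / 8 is the gap in Young's inequality *)
  by have := sqr_ge0 (x + 4 * k); lra.
Qed.

(** Lower and upper bounds on [E (W f(W))] for the primitive [f] of the
    trapezoid. *)
Lemma concentration_step :
  itv_prob P W a b <= 5 / 8 * (b - a) + 5 / 4 * l + 2 * tail_term
    + 2^-1 * (dlt / l) * third_moment + 2 * total_var.
Proof.
pose f := trapezoid_primitive a b l.
have f_le x : `|f x| <= (b - a) / 2 + l by exact: norm_trapezoid_primitive_le.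
have df := is_derive_trapezoid_primitive ab l0.
have cf : continuous f by exact: (is_derive_continuous df).
have up : \int[P]_w (W w * f (W w)) <= (b - a) / 2 + l.
  have c0 : 0 <= (b - a) / 2 + l by move: ab l0; lra.
  apply: (@le_trans _ _ (((b - a) / 2 + l) * \int[P]_w `|W w|)); last first.
    by rewrite -[leRHS]mulr1 ler_wpM2l// abs_moment_W.
  have iW : P.-integrable setT (EFin \o W) by exact: square_integrable1.
  rewrite -RintegralZl//; last exact: integrable_normr.
  apply: (le_trans (ler_norm _)); apply: le_norm_Rintegral => //.
  - apply: measurable_funM => //; apply: (measurableT_comp _ mW).
    exact: continuous_measurable_fun.
  - by move=> w _; rewrite normrM mulrC ler_wpM2r.
  - exact/integrable_mulrl/integrable_normr.
have low := window_derivative A X_sq (continuous_trapezoid a b l) df g_norm.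
rewrite -(stein_identity cf f_le) in low.
have mG := measurable_shift_W mg.
have [_ iGK] := Fubini_Khat A X_sq mG (fun z => g_norm _).
have iv := integrable_Khat_var A X_sq.
have iK := integrable_Khat_mean A X_sq.
have mG2 : measurable_fun setT (fun z : T * R => g (W z.1 + z.2) ^+ 2).
  exact: measurable_funX.
have int1 : P.-integrable setT (EFin \o (fun _ : T => 1)).
  exact: finite_measure_integrable_cst.
have [|E2 iE2 iE2'] := Fubini_dominated mwindow window_fin mG2 int1.
  by move=> w t _; rewrite ger0_norm ?sqr_ge0// expr_le1.
have sqr_le : \int[mu]_(t in window) \int[P]_w (g (W w + t) ^+ 2) <=
    b - a + 2 * l.
  rewrite -E2 -[leRHS](Rintegral_probability_cst P); apply: le_Rintegral => //.
    exact: finite_measure_integrable_cst.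
  by move=> w _ /=; exact: (Rintegral_trapezoid_sqr ab l0 (W w)).
have mK : `|\int[mu]_(t in window) ((m t - m 0) * Khat_mean t)| <=
    2^-1 * (dlt / l * third_moment).
  rewrite -kernel_moment_cst//.
  rewrite [X in `|X|](_ : _ =
      \int[mu]_(t in window) \int[P]_w ((m t - m 0) * Khat t w)); last first.
    apply: eq_Rintegral => t _; rewrite RintegralZl//.
    exact: (square_integrable1 (Khat_sq A X_sq t)).
  apply: (window_dominated A X_sq (G := fun z => m z.2 - m 0) (M := 1)).
  - apply: measurable_funB; last exact: measurable_cst.
    exact: (measurableT_comp mm measurable_snd).
  - move=> z; have := m_ge0 z.2; have := m_ge0 0; have := m_le1 z.2.
    by have := m_le1 0; rewrite ler_norml => *; apply/andP; split; lra.
  - exact: square_integrable_cst.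
  - by move=> w t _; rewrite mulrC m_increment.
have imK : mu.-integrable window (EFin \o (fun t => m t * Khat_mean t)).
  apply: (@le_integrable_mul_bounded _ _ _ _ _ _ _ 1) => //.
    exact: measurable_funTS.
  by move=> t _; rewrite ger0_norm.
have imK0 : mu.-integrable window (EFin \o (fun t => m 0 * Khat_mean t)).
  exact: integrable_mulrl.
have mKE : \int[mu]_(t in window) (m t * Khat_mean t) =
    \int[mu]_(t in window) ((m t - m 0) * Khat_mean t) +
    m 0 * \int[mu]_(t in window) Khat_mean t.
  rewrite -RintegralZl// -RintegralD//.
    by apply: eq_Rintegral => t _; rewrite mulrBl subrK.
  under eq_fun do rewrite mulrBl.
  exact: integrable_subr.
have lowI : \int[mu]_(t in window) (m t * Khat_mean t) -
    8^-1 * \int[mu]_(t in window) \int[P]_w (g (W w + t) ^+ 2) -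
    2 * total_var <=
    \int[mu]_(t in window) \int[P]_w (g (W w + t) * Khat t w).
  have i8 : mu.-integrable window
      (EFin \o (fun t => 8^-1 * \int[P]_w (g (W w + t) ^+ 2))).
    exact: integrable_mulrl.
  have i2 : mu.-integrable window (EFin \o (fun t => 2 * Khat_var t)).
    exact: integrable_mulrl.
  rewrite -RintegralZl// -RintegralZl// -RintegralB// -RintegralB//.
    apply: le_Rintegral => //.
    by apply: integrable_subr => //; exact: integrable_subr.
  exact: integrable_subr.
have prob_le : itv_prob P W a b <= m 0.
  apply: le_Rintegral => //.
    exact: integrable_itv_bool.
  move=> w _; rewrite addr0; case: (boolP (a <= W w <= b)) => [Wab|_];
    last exact: g_ge0.
  by rewrite trapezoid_mid.
have K1 := Rintegral_Khat_mean.
have m0 := m_ge0 0; have m1 := m_le1 0; have t0 := tail_term_ge0 X A.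
move: up low sqr_le mK mKE lowI prob_le K1 m0 m1 t0 dlt_ge0.
rewrite !ler_norml.
set I1 := \int[mu]_(t in window) (m t * Khat_mean t).
set I2 := \int[mu]_(t in window) ((m t - m 0) * Khat_mean t).
set I3 := \int[mu]_(t in window) Khat_mean t.
set I4 := \int[mu]_(t in window) \int[P]_w (g (W w + t) ^+ 2).
set I5 := \int[mu]_(t in window) \int[P]_w (g (W w + t) * Khat t w).
set I6 := \int[P]_w (W w * f (W w)).
move: I1 I2 I3 I4 I5 I6 => I1 I2 I3 I4 I5 I6.
move: tail_term total_var (m 0) (dlt / l) third_moment (itv_prob _ _ _ _).
move=> r2 r5 m0 dl r3 p.
move=> up /andP[low1 low2] I4le /andP[I2a I2b] I1E I5ge pm I3ge m0a m0b r20 dl0.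
have : m0 * (1 - r2) <= m0 * I3 by rewrite ler_wpM2l.
have : m0 * r2 <= r2 by rewrite ler_piMl.
lra.
Qed.

End concentration_at_scale.

Lemma third_moment_ge0 : 0 <= third_moment.
Proof.
apply: sumr_ge0 => i _; apply: Rintegral_ge0 => w _.
by rewrite mulr_ge0// le_min sqr_ge0 ler01.
Qed.

Lemma total_var_ge0 : 0 <= total_var.
Proof. by apply: Rintegral_ge0 => t _; exact: Khat_var_ge0. Qed.

(** With [b - a = l], [concentration_step] bounds the supremum of the
    probabilities of intervals of length [l] by half of itself plus an error. *)
Lemma concentration_small (l : R) : 0 < l -> third_moment <= l ->
  forall x, itv_prob P W x (x + l) <=
    15 / 4 * l + 4 * tail_term + 4 * total_var.
Proof.
move=> l0 lM x.
pose S := range (fun y => itv_prob P W y (y + l)).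
have S1 : has_ubound S by exists 1 => _ [y _ <-]; exact: itv_prob_le1.
have Sle y : itv_prob P W y (y + l) <= sup S.
  by apply: ub_le_sup => //; exists y.
apply: le_trans (Sle x) _.
have s0 : 0 <= sup S.
  by apply: le_trans (Sle 0); apply: Rintegral_ge0 => w _.
have key : sup S <= 15 / 8 * l + 2 * tail_term + 2^-1 * sup S + 2 * total_var.
  apply: ge_sup => [|_ [y _ <-]]; first by exists (itv_prob P W 0 (0 + l)), 0.
  have yl : y <= y + l by rewrite lerDl ltW.
  have := concentration_step yl l0 Sle.
  have : sup S / l * third_moment <= sup S.
    rewrite mulrAC ler_pdivrMr// ler_wpM2l//.
  move: tail_term total_var third_moment (itv_prob _ _ _ _) (sup S) => *; lra.
by move: tail_term total_var key => *; lra.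
Qed.

Lemma concentration (l a b : R) : 0 < l -> third_moment <= l -> a <= b ->
  itv_prob P W a b <=
    5 / 8 * (b - a) + 25 / 8 * l + 4 * tail_term + 4 * total_var.
Proof.
move=> l0 lM ab; have := concentration_step ab l0 (concentration_small l0 lM).
set e := 15 / 4 * l + 4 * tail_term + 4 * total_var.
have e0 : 0 <= e.
  have := tail_term_ge0 X A; have := total_var_ge0; rewrite /e.
  by move: tail_term total_var => *; lra.
have : e / l * third_moment <= e by rewrite mulrAC ler_pdivrMr// ler_wpM2l.
by rewrite /e; move: tail_term total_var third_moment (itv_prob _ _ _ _) => *;
  lra.
Qed.

End stein_bounds.

(** * Normal approximation of smoothed probabilities *)

Section smooth_bound.
Context d (T : measurableType d) (R : realType) (P : probability T R).
Context (J : finType) (X : J -> {RV P >-> R}) (A : J -> {set J}).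
Local Notation mu := (@lebesgue_measure R).
Local Notation W := (total_sum X).
Local Notation Y := (neighborhood_sum X A).
Local Notation Khat := (Khat X A).
Local Notation Khat_mean := (Khat_mean X A).
Local Notation Khat_var := (Khat_var X A).
Local Notation tail_term := (tail_term X A).
Local Notation weighted_var := (weighted_var X A).
Local Notation third_moment := (kernel_moment X A (fun=> 1)).
Local Notation fourth_moment := (kernel_moment X A W).
Hypothesis X_sq : forall i, square_integrable P (X i).
Hypothesis stein_identity : forall (f : R -> R) (M : R), continuous f ->
  (forall x, `|f x| <= M) ->
  \int[P]_w (W w * f (W w)) =
  \sum_i \int[P]_w (X i w * (f (W w) - f (W w - Y i w))).
Hypothesis sumXY : \sum_i \int[P]_w (X i w * Y i w) = 1.

Definition covariance_error : R :=
  \int[P]_w `|\sum_i (X i w * Y i w - \int[P]_v (X i v * Y i v))|.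

Let W_sq : square_integrable P W := total_sum_sq X_sq.
Let Y_sq i : square_integrable P (Y i) := neighborhood_sum_sq A X_sq i.
Let mW : measurable_fun setT W := W_sq.1.
Let mW1 : measurable_fun setT (fun z : T * R => W z.1).
Proof. exact: (measurableT_comp mW measurable_fst). Qed.
Let mwindow : measurable (@window R) := @measurable_window R.

(** The sum of the [E (X i * Y i)] is 1, so that the difference is, up to sign,
    the expectation of [u] times the centered sum of the [X i * Y i]. *)
Lemma covariance_error_bound (u : T -> R) : measurable_fun setT u ->
  (forall w, `|u w| <= 1) ->
  `|\int[P]_w u w - \sum_i \int[P]_w (X i w * (u w * Y i w))| <=
  covariance_error.
Proof.
move=> mu_ u1.
have iXY i : P.-integrable setT (EFin \o (fun w => X i w * Y i w)).
  exact: square_integrableM.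
have iuXY i : P.-integrable setT (EFin \o (fun w => X i w * (u w * Y i w))).
  under eq_fun do rewrite mulrCA.
  exact: (le_integrable_mul_bounded _ _ (fun w _ => u1 w)).
have iu : P.-integrable setT (EFin \o u).
  exact: (probability_bounded_integrable P mu_ u1).
have iS : P.-integrable setT (EFin \o (fun w =>
    \sum_i (X i w * Y i w - \int[P]_v (X i v * Y i v)))).
  apply: integrable_sumr => // i; apply: integrable_subr => //.
  exact: finite_measure_integrable_cst.
rewrite -Rintegral_sum// -RintegralB//; last exact: integrable_sumr.
apply: le_norm_Rintegral => //; last exact: integrable_normr.
  apply: measurable_funB => //; apply: integrable_measurable.
  exact: integrable_sumr.
move=> w _; rewrite sumrB sumXY.
rewrite (_ : _ - _ = - u w * (\sum_i X i w * Y i w - 1)).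
  by rewrite normrM normrN ler_piMl.
rewrite mulrBr mulr1 mulNr opprK addrC mulr_sumr; congr (- _ + _).
by apply: eq_bigr => i _; rewrite mulrCA.
Qed.

Lemma kernel_moment_W6 :
  kernel_moment X A (fun w => `|W w| + 6) <= fourth_moment + 6 * third_moment.
Proof.
rewrite /kernel_moment mulr_sumr -big_split/=; apply: ler_sum => i _.
have i1 := integrable_kernel_moment A X_sq i (square_integrable_cst P 1).
have iW := integrable_kernel_moment A X_sq i W_sq.
rewrite -RintegralZl// -RintegralD//; last exact: integrable_mulrl.
apply: le_Rintegral => //.
- apply: integrable_kernel_moment => //; apply: square_integrableD.
    exact: square_integrable_norm.
  exact: square_integrable_cst.
- by apply: integrable_addr => //; exact: integrable_mulrl.
- move=> w _; rewrite mul1r !normrM mulrA -mulrDl ler_wpM2r//.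
    by rewrite le_min sqr_ge0 ler01.
  by rewrite -mulrDl ler_wpM2r// ger0_norm// addr_ge0.
Qed.

Section ramp_part.
Variables (z l dlt c : R).
Hypotheses (l0 : 0 < l) (c0 : 0 < c).
Hypothesis Wdlt : forall x, itv_prob P W x (x + l) <= dlt.

Let D (w : T) (t : R) : R := ramp l (W w + t - z) - ramp l (W w - z).
Let D_norm w t : `|D w t| <= 1.
Proof.
rewrite /D; have := ramp_le1 l (W w + t - z); have := ramp_ge0 l (W w + t - z).
have := ramp_le1 l (W w - z); have := ramp_ge0 l (W w - z).
by rewrite ler_norml => *; apply/andP; split; lra.
Qed.
Let mD2 : measurable_fun setT (fun x : T * R => D x.1 x.2).
Proof.
apply: measurable_funB; first exact: measurable_ramp_shift.
apply: (measurableT_comp (measurable_ramp l)).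
by apply: measurable_funB.
Qed.
Let mD t : measurable_fun setT (D^~ t).
Proof.
apply: measurable_funB; apply: (measurableT_comp (measurable_ramp l));
  apply: measurable_funB => //; exact: measurable_funD.
Qed.
Let iD t : P.-integrable setT (EFin \o D^~ t).
Proof. exact: (probability_bounded_integrable P (mD t) (D_norm ^~ t)). Qed.

Let dlt_ge0 : 0 <= dlt / l.
Proof.
rewrite divr_ge0 ?(ltW l0)//; apply: le_trans (Wdlt 0).
by apply: Rintegral_ge0 => w _.
Qed.

Let D_abs t : \int[P]_w `|D w t| <= `|t| * (dlt / l).
Proof. exact: Rintegral_norm_ramp_increment. Qed.

Let m t : R := \int[P]_w D w t.
Let m_le t : `|m t| <= `|t| * (dlt / l).
Proof. by apply: le_trans (D_abs t); exact: le_normr_Rintegral. Qed.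

Let mm : measurable_fun setT m.
Proof.
have -> : m = (fun t => \int[P]_w ramp l (W w + t - z)
  - \int[P]_w ramp l (W w - z)).
  apply/funext => t; rewrite -RintegralB//; last exact: integrable_ramp_shift.
  apply: (probability_bounded_integrable P (M := 1)).
    apply: (measurableT_comp (measurable_ramp l)).
    by apply: measurable_funB => //; exact: measurable_funD.
  by move=> w; rewrite ger0_norm ?ramp_ge0// ramp_le1.
apply: measurable_funB; last exact: measurable_cst.
apply: (@measurable_Rintegral_ge0 _ _ _ P
  (fun x => ramp l (W x.1 + x.2 - z))) => [|x].
  exact: measurable_ramp_shift.
exact: ramp_ge0.
Qed.

(** Young's inequality [x * y <= x^2 / (2 c |t|) + c |t| y^2 / 2], combined
    with [D^2 <= |D|], which holds because the ramp takes values in [0, 1]. *)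
Let young t :
  `|\int[P]_w (D w t * (Khat t w - Khat_mean t))| <=
  (2 * c)^-1 * (dlt / l) + c / 2 * (`|t| * Khat_var t).
Proof.
have sK := Khat_centered_sq A X_sq t.
have V0 := Khat_var_ge0 X A t.
have rhs0 : 0 <= (2 * c)^-1 * (dlt / l) + c / 2 * (`|t| * Khat_var t).
  have c2 : 0 <= c / 2 by rewrite divr_ge0// ltW.
  have ci : 0 <= (2 * c)^-1 by rewrite invr_ge0; move: c0; lra.
  by apply: addr_ge0; apply: mulr_ge0 => //; exact: mulr_ge0.
have [t0|t0] := eqVneq t 0.
  rewrite (_ : \int[P]_w _ = 0) ?normr0//.
  have := Rintegral_probability_cst P 0; rewrite -[in RHS]/(0 : R).
  move=> <-; apply: eq_Rintegral => w _.
  by rewrite /D t0 addr0 subrr mul0r.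
have at0 : 0 < `|t| by rewrite normr_gt0.
pose k := (2 * c * `|t|)^-1.
have k0 : 0 < k by rewrite invr_gt0 mulr_gt0// mulr_gt0.
apply: (@le_trans _ _ (\int[P]_w (k * `|D w t| +
    c / 2 * `|t| * (Khat t w - Khat_mean t) ^+ 2))).
  apply: le_norm_Rintegral => //.
  - apply: measurable_funM => //; exact: sK.1.
  - move=> w _; rewrite normrM.
    apply: (@le_trans _ _ (k * `|D w t| ^+ 2 +
        c / 2 * `|t| * (Khat t w - Khat_mean t) ^+ 2)).
      rewrite -(real_normK (num_real (Khat t w - Khat_mean t))).
      set x := `|D w t|; set y := `| _ - _ |.
      have := sqr_ge0 (x - c * `|t| * y).
      rewrite -(pmulr_rge0 _ k0).
      suff -> : k * (x - c * `|t| * y) ^+ 2 =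
        k * x ^+ 2 + c / 2 * `|t| * y ^+ 2 - x * y by rewrite subr_ge0.
      by rewrite /k; field; rewrite !gt_eqF.
    rewrite lerD2r ler_pM2l// expr2 ler_piMl//.
  - apply: integrable_addr => //; apply: integrable_mulrl => //.
      exact: integrable_normr.
    exact: sK.2.
rewrite RintegralD//; last 2 first.
- by apply: integrable_mulrl => //; exact: integrable_normr.
- by apply: integrable_mulrl => //; exact: sK.2.
rewrite (RintegralZl _ measurableT (integrable_normr measurableT (iD t))).
rewrite (RintegralZl _ measurableT sK.2).
rewrite -/(Khat_var t) [c / 2 * (`|t| * _)]mulrA lerD2r.
apply: (le_trans (ler_wpM2l (ltW k0) (D_abs t))).
by rewrite le_eqVlt; apply/orP; left; apply/eqP; rewrite /k; field;
  rewrite !gt_eqF.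
Qed.

(** [Khat] is split into its mean, treated by [window_dominated], and its
    fluctuation, treated by Young's inequality. *)
Lemma ramp_part_bound :
  `|\int[mu]_(t in window) \int[P]_w (D w t * Khat t w)| <=
  c^-1 * (dlt / l) + c / 2 * weighted_var + 2^-1 * (dlt / l) * third_moment.
Proof.
have [_ iDK] := Fubini_Khat A X_sq mD2 (fun x => D_norm x.1 x.2).
have mG : measurable_fun setT (fun x : T * R => m x.2).
  exact: (measurableT_comp mm measurable_snd).
have m1 t : `|m t| <= 1.
  rewrite -[leRHS](Rintegral_probability_cst P); apply: le_norm_Rintegral => //.
  exact: finite_measure_integrable_cst.
have iK t : P.-integrable setT (EFin \o Khat t).
  exact: square_integrable1 (Khat_sq A X_sq t).
have [_ imK'] := Fubini_Khat A X_sq mG (fun x => m1 x.2).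
have mKE t : \int[P]_w (m t * Khat t w) = m t * Khat_mean t.
  by rewrite RintegralZl.
have imK : mu.-integrable window (EFin \o (fun t => m t * Khat_mean t)).
  by move: imK'; apply: eq_integrable => // t _ /=; rewrite mKE.
have bmK : `|\int[mu]_(t in window) (m t * Khat_mean t)| <=
    2^-1 * (dlt / l) * third_moment.
  rewrite -mulrA -(kernel_moment_cst A X_sq dlt_ge0).
  have H := window_dominated A X_sq mG (fun x => m1 x.2)
    (square_integrable_cst P (dlt / l)).
  rewrite [X in `|X|](_ : _ =
      \int[mu]_(t in window) \int[P]_w (m t * Khat t w)).
    by apply: H => w t _ /=; rewrite mulrC m_le.
  by apply: eq_Rintegral => t _; rewrite mKE.
have split_t t : \int[P]_w (D w t * Khat t w) =
    \int[P]_w (D w t * (Khat t w - Khat_mean t)) + m t * Khat_mean t.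
  by rewrite (Rintegral_mul_Khat A X_sq t (mD t) (D_norm ^~ t)) [_ * m t]mulrC.
pose F t : R := \int[P]_w (D w t * Khat t w) - m t * Khat_mean t.
have iF : mu.-integrable window (EFin \o F) by exact: integrable_subr.
have FE t : F t = \int[P]_w (D w t * (Khat t w - Khat_mean t)).
  by rewrite /F split_t addrK.
have iV := integrable_weighted_Khat_var A X_sq.
have icst (k : R) : mu.-integrable window (EFin \o (fun=> k)).
  apply: (@window_bounded_integrable _ _ `|k|) => //.
have bF : `|\int[mu]_(t in window) F t| <=
    c^-1 * (dlt / l) + c / 2 * weighted_var.
  apply: (@le_trans _ _ (\int[mu]_(t in window)
      ((2 * c)^-1 * (dlt / l) + c / 2 * (`|t| * Khat_var t)))).
    apply: le_norm_Rintegral => //.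
    - exact: integrable_measurable iF.
    - by move=> t _; rewrite FE young.
    - by apply: integrable_addr => //; exact: integrable_mulrl.
  rewrite RintegralD//; last exact: integrable_mulrl.
  rewrite RintegralZl// Rintegral_cst//.
  have -> : fine (mu window) = 2 by rewrite lebesgue_window.
  rewrite lerD2r le_eqVlt; apply/orP; left; apply/eqP; field.
  by rewrite !gt_eqF.
have -> : \int[mu]_(t in window) \int[P]_w (D w t * Khat t w) =
    \int[mu]_(t in window) F t + \int[mu]_(t in window) (m t * Khat_mean t).
  rewrite -RintegralD//; apply: eq_Rintegral => t _.
  by rewrite /F subrK.
by rewrite (le_trans (ler_normD _ _))// lerD.
Qed.

(** [E h(W) - N h] is the expectation of [f1 (W) - W * f (W)]; each of the two
    terms is expanded along the kernel, and Stein's equation splits the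
    difference of the expansions into the smooth part [E] and the ramp part
    [D]. *)
Lemma smooth_step_bound :
  `|\int[P]_w smooth_step z l (W w) - gauss_mean (smooth_step z l)| <=
  covariance_error + 2 * tail_term + 2^-1 * fourth_moment + 3 * third_moment +
  2^-1 * (dlt / l) * third_moment + c^-1 * (dlt / l) + c / 2 * weighted_var.
Proof.
pose h := smooth_step z l; pose f := stein_sol h; pose f1 := stein_deriv h.
have hc : continuous h := continuous_smooth_step z l.
have ha : forall x y, x <= y -> h y <= h x := smooth_step_anti z l0.
have h0 : forall x, 0 <= h x := smooth_step_ge0 z l.
have h1 : forall x, h x <= 1 := smooth_step_le1 z l.
have f1_le1 : forall x, `|f1 x| <= 1 := stein_deriv_le1 hc ha h0 h1.
have df : forall x : R, is_derive x 1 f (f1 x) := is_derive_stein_sol hc h0 h1.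
have cf : continuous f := is_derive_continuous df.
have cf1 : continuous f1 := continuous_stein_deriv hc h0 h1.
have f_le6 x : `|f x| <= 6.
  by rewrite ger0_norm ?(stein_sol_ge0 hc ha h0 h1)// (stein_sol_le6 hc ha h0
    h1).
have mf1 : measurable_fun setT f1 by exact: continuous_measurable_fun.
have mf : measurable_fun setT f by exact: continuous_measurable_fun.
have mh : measurable_fun setT h by exact: continuous_measurable_fun.
have mf1W : measurable_fun setT (fun w => f1 (W w)) := measurableT_comp mf1 mW.
have mG1 : measurable_fun setT (fun x : T * R => f1 (W x.1)).
  exact: (measurableT_comp mf1 mW1).
have mG2 : measurable_fun setT (fun x : T * R => f1 (W x.1 + x.2)).
  exact: (measurable_shift_W X_sq).
have if1W : P.-integrable setT (EFin \o (fun w => f1 (W w))).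
  exact: (probability_bounded_integrable P mf1W (fun w => f1_le1 (W w))).
have iWf : P.-integrable setT (EFin \o (fun w => W w * f (W w))).
  under eq_fun do rewrite mulrC.
  apply: (le_integrable_mul_bounded _ _ (fun w _ => f_le6 (W w))) => //.
    exact: (measurableT_comp mf mW).
  exact: square_integrable1.
have hE : \int[P]_w h (W w) - gauss_mean h =
    \int[P]_w f1 (W w) - \int[P]_w (W w * f (W w)).
  rewrite -RintegralB// -{1}(Rintegral_probability_cst P (gauss_mean h)).
  rewrite -RintegralB//; last 2 first.
  - apply: (probability_bounded_integrable P (M := 1)).
      exact: (measurableT_comp mh mW).
    by move=> w; rewrite ger0_norm.
  - exact: finite_measure_integrable_cst.
  by apply: eq_Rintegral => w _; rewrite -stein_equation.
have f1_incr w t : `|(f1 (w + t) - h (w + t)) - (f1 w - h w)| <=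
    (`|w| + 6) * `|t| := stein_deriv_increment hc ha h0 h1 w t.
have h_incr x y : h x - h y = ramp l (y - z) - ramp l (x - z).
  by rewrite /h /smooth_step; lra.
(* from here on h, f and f1 enter only through the properties collected above *)
rewrite -/h hE; clearbody h f f1.
have b1 := covariance_error_bound mf1W (fun w => f1_le1 (W w)).
have b2 := window_constant A X_sq mf1W (fun w => f1_le1 (W w)).
have b3 := window_derivative A X_sq cf1 df f1_le1.
rewrite -(stein_identity cf f_le6) in b3.
have i1 : mu.-integrable window
    (EFin \o (fun t => \int[P]_w (f1 (W w) * Khat t w))).
  exact: (Fubini_Khat A X_sq mG1 (fun x => f1_le1 _)).2.
have i2 : mu.-integrable window
    (EFin \o (fun t => \int[P]_w (f1 (W w + t) * Khat t w))).
  exact: (Fubini_Khat A X_sq mG2 (fun x => f1_le1 _)).2.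
have f1h_le2 x : `|f1 x - h x| <= 2.
  apply: (le_trans (ler_normB _ _)); rewrite (ger0_norm (h0 x)).
  exact: (lerD (f1_le1 x) (h1 x)).
pose E (w : T) (t : R) : R :=
  (f1 (W w + t) - h (W w + t)) - (f1 (W w) - h (W w)).
have E_le w t : `|E w t| <= (`|W w| + 6) * `|t|.
  exact: f1_incr.
have E_norm w t : `|E w t| <= 4.
  apply: (le_trans (ler_normB _ _)); have -> : 4 = 2 + 2 :> R by rewrite -natrD.
  exact: (lerD (f1h_le2 _) (f1h_le2 _)).
have mE : measurable_fun setT (fun x : T * R => E x.1 x.2).
  exact: (measurable_funB (measurable_funB mG2 (measurable_shift_W X_sq mh))
    (measurable_funB mG1 (measurableT_comp mh mW1))).
have iE : mu.-integrable window
    (EFin \o (fun t => \int[P]_w (E w t * Khat t w))).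
  exact: (Fubini_Khat A X_sq mE (fun x => E_norm x.1 x.2)).2.
have iDK : mu.-integrable window
    (EFin \o (fun t => \int[P]_w (D w t * Khat t w))).
  exact: (Fubini_Khat A X_sq mD2 (fun x => D_norm x.1 x.2)).2.
have bE : `|\int[mu]_(t in window) \int[P]_w (E w t * Khat t w)| <=
    2^-1 * (fourth_moment + 6 * third_moment).
  apply: (@le_trans _ _ (2^-1 * kernel_moment X A (fun w => `|W w| + 6))).
    apply: (window_dominated A X_sq mE (fun x => E_norm x.1 x.2)).
      apply: square_integrableD; first exact: square_integrable_norm.
      exact: square_integrable_cst.
    by move=> w t _; exact: E_le.
  by rewrite ler_pM2l// kernel_moment_W6.
have bD := ramp_part_bound.
have iK t : P.-integrable setT (EFin \o Khat t).
  exact: square_integrable1 (Khat_sq A X_sq t).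
have decomp : \int[mu]_(t in window) \int[P]_w (f1 (W w) * Khat t w) -
    \int[mu]_(t in window) \int[P]_w (f1 (W w + t) * Khat t w) =
    \int[mu]_(t in window) \int[P]_w (D w t * Khat t w) -
    \int[mu]_(t in window) \int[P]_w (E w t * Khat t w).
  rewrite -RintegralB; [|exact: mwindow|exact: i1|exact: i2].
  rewrite -[RHS]RintegralB; [|exact: mwindow|exact: iDK|exact: iE].
  apply: eq_Rintegral => t _.
  have ibK (u : T -> R) (M : R) : measurable_fun setT u ->
      (forall w, `|u w| <= M) ->
      P.-integrable setT (EFin \o (fun w => u w * Khat t w)).
    by move=> mu_ uM; exact: (le_integrable_mul_bounded _ _ (fun w _ => uM w)).
  have mf1t : measurable_fun setT (fun w => f1 (W w + t)).
    by apply: (measurableT_comp mf1); exact: measurable_funD.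
  have mEt : measurable_fun setT (E^~ t).
    have := @measurable_fun_pair1 _ _ _ _ _ _ _ t mE; exact.
  rewrite -RintegralB//; last 2 first.
  - exact: (ibK _ 1).
  - exact: (ibK _ 1).
  rewrite -RintegralB//; last 2 first.
  - exact: (ibK _ 1 (mD t) (D_norm ^~ t)).
  - exact: (ibK _ 4 mEt (E_norm ^~ t)).
  apply: eq_Rintegral => w _; rewrite /E /D -h_incr.
  move: (f1 (W w + t)) (f1 (W w)) (h (W w + t)) (h (W w)) (Khat t w) => *; ring.
move: b1 b2 b3 bE bD decomp.
set I1 := \int[P]_w f1 (W w); set I2 := \int[P]_w (W w * f (W w)).
set I3 := \int[mu]_(t in window) \int[P]_w (f1 (W w) * Khat t w).
set I4 := \int[mu]_(t in window) \int[P]_w (f1 (W w + t) * Khat t w).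
set I5 := \int[mu]_(t in window) \int[P]_w (D w t * Khat t w).
set I6 := \int[mu]_(t in window) \int[P]_w (E w t * Khat t w).
set I7 := \sum_i _.
move: I1 I2 I3 I4 I5 I6 I7 => I1 I2 I3 I4 I5 I6 I7.
set x := 2^-1 * (dlt / l) * _; set y := c^-1 * _; set v := c / 2 * _.
move: x y v tail_term fourth_moment third_moment covariance_error.
move=> x y v r2 r4 r3 r1; rewrite !ler_norml.
move=> /andP[? ?] /andP[? ?] /andP[? ?] /andP[? ?] /andP[? ?] ?.
by apply/andP; split; lra.
Qed.

End ramp_part.

End smooth_bound.

(** * The Kolmogorov distance *)

Section kolmogorov_distance.
Context d (T : measurableType d) (R : realType) (P : probability T R).
Context (J : finType) (X : J -> {RV P >-> R}) (A : J -> {set J}).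
Local Notation W := (total_sum X).
Local Notation Y := (neighborhood_sum X A).
Local Notation r1 := (covariance_error X A).
Local Notation r2 := (tail_term X A).
Local Notation r3 := (kernel_moment X A (fun=> 1)).
Local Notation r4 := (kernel_moment X A W).
Local Notation r5 := (total_var X A).
Local Notation r6 := (Num.sqrt (weighted_var X A)).
Hypothesis X_sq : forall i, square_integrable P (X i).
Hypothesis stein_identity : forall (f : R -> R) (M : R), continuous f ->
  (forall x, `|f x| <= M) ->
  \int[P]_w (W w * f (W w)) =
  \sum_i \int[P]_w (X i w * (f (W w) - f (W w - Y i w))).
Hypothesis sumXY : \sum_i \int[P]_w (X i w * Y i w) = 1.
Hypothesis EW2 : \int[P]_w (W w ^+ 2) = 1.

Let mW : measurable_fun setT W := (total_sum_sq X_sq).1.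

Lemma weighted_var_ge0 : 0 <= weighted_var X A.
Proof. by apply: Rintegral_ge0 => t _; rewrite mulr_ge0// Khat_var_ge0. Qed.

Lemma integrable_le_bool z :
  P.-integrable setT (EFin \o (fun w => (W w <= z)%R%:R)).
Proof.
apply: (probability_bounded_integrable P (M := 1)).
  by apply: measurable_natr_bool; apply: measurable_fun_ler.
by move=> w; case: (W w <= z); rewrite ?normr1 ?normr0.
Qed.

Lemma integrable_smooth_step_W z l :
  P.-integrable setT (EFin \o (fun w => smooth_step z l (W w))).
Proof.
apply: (probability_bounded_integrable P (M := 1)).
  apply: (measurableT_comp _ mW); apply: continuous_measurable_fun.
  exact: continuous_smooth_step.
by move=> w; rewrite ger0_norm ?smooth_step_ge0// smooth_step_le1.
Qed.

(** The scale [e + r3] of the concentration inequality has to be positive,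
    and [e + r6] is inverted: hence the slack [e]. *)
Lemma kolmogorov_bound_slack (z e : R) : 0 < e ->
  `|\int[P]_w (W w <= z)%R%:R - gauss_cdf z| <=
  r1 + 4 * r2 + 8 * r3 + r4 + 9 / 2 * r5 + 3 / 2 * r6 + 4 * e.
Proof.
move=> e0.
have p2 := tail_term_ge0 X A; have p3 := third_moment_ge0 X A.
have p5 := total_var_ge0 X A; have p6 : 0 <= r6 by exact: sqrtr_ge0.
have p4 : 0 <= r4.
  apply: sumr_ge0 => i _; apply: Rintegral_ge0 => w _.
  by rewrite mulr_ge0// le_min sqr_ge0 ler01.
have [l0 lM] : 0 < e + r3 /\ r3 <= e + r3.
  by move: r3 p3 => r3 p3; split; lra.
pose beta := 25 / 8 * (e + r3) + 4 * r2 + 4 * r5.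
have beta0 : 0 < beta.
  by rewrite /beta; move: r2 r3 r5 p2 p3 p5 {l0 lM} => *; lra.
(* the choice of L makes the ratio of the concentration bound to L equal to
   5/8 + 1/2 *)
pose L := 2 * beta; have L0 : 0 < L by rewrite mulr_gt0.
have Wdlt x : itv_prob P W x (x + L) <= 9 / 8 * L.
  have xL : x <= x + L by rewrite lerDl ltW.
  have := concentration X_sq stein_identity sumXY EW2 l0 lM xL.
  rewrite (_ : 9 / 8 * L = 5 / 8 * (x + L - x) + beta); last first.
    by rewrite /L; field.
  by rewrite /beta !addrA.
have dL : 9 / 8 * L / L = 9 / 8 by rewrite mulfK// gt_eqF.
pose s := e + r6; have s0 : 0 < s by rewrite ltr_pwDl.
have ws : weighted_var X A <= s ^+ 2.
  rewrite -(sqr_sqrtr weighted_var_ge0) ler_sqr ?nnegrE ?(ltW s0)//.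
  by rewrite /s lerDr ltW.
(* minimizes (9/8) / c + c s^2 / 2, both terms being then 3/4 s *)
pose c := 3 / 2 / s; have c0 : 0 < c by rewrite divr_gt0.
have cE : c^-1 * (9 / 8) = 3 / 4 * s by rewrite /c; field; rewrite gt_eqF.
have cw : c / 2 * weighted_var X A <= 3 / 4 * s.
  apply: (@le_trans _ _ (c / 2 * s ^+ 2)).
    by rewrite ler_wpM2l// divr_ge0// ltW.
  by rewrite /c le_eqVlt; apply/orP; left; apply/eqP; field; rewrite gt_eqF.
have smooth z' : `|\int[P]_w smooth_step z' L (W w) -
    gauss_mean (smooth_step z' L)| <=
    r1 + 2 * r2 + 2^-1 * r4 + 3 * r3 + 9 / 16 * r3 + 3 / 2 * s.
  have := smooth_step_bound X_sq stein_identity sumXY z' L0 c0 Wdlt.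
  rewrite dL cE => /le_trans; apply.
  by move: cw; set q := c / 2 * _ => cw; clearbody q; clear - cw; lra.
(* the smoothed half-lines starting at z and at z - L enclose the indicator *)
have up : \int[P]_w (W w <= z)%R%:R <= \int[P]_w smooth_step z L (W w).
  apply: le_Rintegral => //; [exact: integrable_le_bool|
    exact: integrable_smooth_step_W|].
  move=> w _; case: (leP (W w) z) => Wz; last exact: smooth_step_ge0.
  by rewrite /smooth_step ramp_low ?subr0// subr_le0.
have low : \int[P]_w smooth_step (z - L) L (W w) <= \int[P]_w (W w <= z)%R%:R.
  apply: le_Rintegral => //; [exact: integrable_smooth_step_W|
    exact: integrable_le_bool|].
  move=> w _; case: (leP (W w) z) => Wz; first exact: smooth_step_le1.
  by rewrite /smooth_step ramp_high ?subrr//; lra.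
have LE : L / 4 = 25 / 16 * (e + r3) + 2 * r2 + 2 * r5.
  by rewrite /L /beta; field.
have Nup := gauss_mean_smooth_step_le z L0.
have Nlow := gauss_mean_smooth_step_ge z L0.
have s1 := smooth z; have s2 := smooth (z - L).
move: up low Nup Nlow s1 s2; rewrite LE /s !ler_norml.
move: (gauss_mean (smooth_step z L)) (gauss_mean (smooth_step (z - L) L)).
move: (\int[P]_w smooth_step z L (W w)) (\int[P]_w smooth_step (z - L) L (W w)).
move: (\int[P]_w (W w <= z)%R%:R) (gauss_cdf z).
move: e0 p2 p3 p4 p5 p6; clear.
move: r1 r2 r3 r4 r5 r6 => a1 a2 a3 a4 a5 a6 e0 p2 p3 p4 p5 p6 F Phi I1 I2 N1
  N2.
move=> ? ? ? ? /andP[? ?] /andP[? ?].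
by apply/andP; split; lra.
Qed.

End kolmogorov_distance.

(** * Expectations and variances as real integrals *)

Section expectation_real.
Context d (T : measurableType d) (R : realType) (P : probability T R).

Lemma expectation_EFin (f : T -> R) : P.-integrable setT (EFin \o f) ->
  ('E_P[f] = (\int[P]_w f w)%:E)%E.
Proof. by move=> intf; rewrite unlock Rintegral_EFin. Qed.

Lemma fine_expectation (f : T -> R) : fine 'E_P[f]%E = \int[P]_w f w.
Proof. by rewrite unlock. Qed.

Lemma variance_EFin (f : T -> R) : square_integrable P f ->
  ('V_P[f] = (\int[P]_w (f w - \int[P]_v f v) ^+ 2)%:E)%E.
Proof.
move=> sf; rewrite /variance unlock fine_expectation expectation_EFin.
  by congr EFin; apply: eq_Rintegral => w _; rewrite expr2.
have := (square_integrableD sf (square_integrable_cst P (- \int[P]_v f v))).2.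
by apply: eq_integrable => // w _ /=; rewrite expr2.
Qed.

(** As the mean is 0, the variance is the integral of the square. *)
Lemma centered_square_integrable (f : {RV P >-> R}) :
  ('E_P[f] = 0)%E -> ('V_P[f] < +oo)%E -> square_integrable P f.
Proof.
move=> f0; rewrite /variance unlock f0 unlock => Vf; split => //.
apply/integrableP; split.
  by apply/measurable_EFinP; exact: measurable_funX.
apply: le_lt_trans Vf; rewrite le_eqVlt; apply/orP; left; apply/eqP.
apply: eq_integral => w _ /=; rewrite ger0_norm ?sqr_ge0//.
by rewrite !fctE /= subr0 expr2.
Qed.

End expectation_real.

(** * Consequences of local dependence *)

Section local_dependence_identities.
Context d (T : measurableType d) (R : realType) (P : probability T R).
Context (J : finType) (X : J -> {RV P >-> R}) (A : J -> {set J}).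
Local Notation W := (total_sum X).
Local Notation Y := (neighborhood_sum X A).
Hypothesis X_sq : forall i, square_integrable P (X i).
Hypothesis X_mean0 : forall i, \int[P]_w X i w = 0.
Hypothesis indep : forall i, independent_of_family X (X i) (~: A i).

Definition outer_sum (i : J) (w : T) : R := \sum_(j in ~: A i) X j w.

Lemma outer_sumE i w : outer_sum i w = W w - Y i w.
Proof.
apply/eqP; rewrite eq_sym subr_eq; apply/eqP.
rewrite /total_sum (bigID (fun j => j \in A i))/= addrC; congr (_ + _).
by apply: eq_bigl => j; rewrite inE.
Qed.

Lemma total_sum_mean0 : \int[P]_w W w = 0.
Proof.
rewrite /total_sum Rintegral_sum//; last first.
  by move=> i; exact: square_integrable1.
by rewrite big1.
Qed.

Lemma measurable_outer_sum i : measurable_fun setT (outer_sum i).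
Proof.
have [] : square_integrable P (outer_sum i) by exact: square_integrable_sum.
by [].
Qed.

HB.instance Definition _ i :=
  isMeasurableFun.Build _ _ T R (outer_sum i) (measurable_outer_sum i).

(** Seen as a function on the measurable space generated by the [X j], [j] not
    in [A i], the sum of these variables is measurable. *)
Lemma outer_sum_sigma_family i (C : set R) : measurable C ->
  sigma_family X (~: A i) (outer_sum i @^-1` C).
Proof.
move=> mC; rewrite /sigma_family.
set G := \bigcup_(j in _) _.
have mXj j : j \in ~: A i ->
    measurable_fun (setT : set (g_sigma_algebraType G)) (X j).
  move=> jA _ B mB; apply: sub_sigma_algebra; exists j => //.
  by exists B.
have mV : measurable_fun (setT : set (g_sigma_algebraType G))
    (fun w => \sum_(j <- enum (~: A i)) X j w : R).
  have : {subset enum (~: A i) <= ~: A i} by move=> j; rewrite mem_enum.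
  elim: (enum _) => [|j s IHs] sA.
    by under eq_fun do rewrite big_nil; exact: measurable_cst.
  under eq_fun do rewrite big_cons; apply: measurable_funD.
    by apply: mXj; apply: sA; rewrite mem_head.
  by apply: IHs => k ks; apply: sA; rewrite in_cons ks orbT.
have := mV measurableT _ mC; rewrite setTI.
rewrite (_ : (fun w => _) = outer_sum i)//.
by apply/funext => w; rewrite /outer_sum big_enum.
Qed.

Lemma outer_sum_indep i (g : R -> R) : measurable_fun setT g ->
  P.-integrable setT (EFin \o (fun w => g (W w - Y i w))) ->
  P.-integrable setT (EFin \o (fun w => X i w * g (W w - Y i w))) /\
  \int[P]_w (X i w * g (W w - Y i w)) = 0.
Proof.
move=> mg intg.
have VE : outer_sum i = (fun w => W w - Y i w).
  by apply/funext => w; exact: outer_sumE.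
have := @independent_mul_mean0 _ _ _ P (X i) (outer_sum i : {RV P >-> R}) g.
rewrite /= VE; apply => //; last exact: square_integrable1.
move=> B C mB mC; rewrite -VE; apply: indep.
  by exists B => //; rewrite setTI.
exact: outer_sum_sigma_family.
Qed.

Let mY i : measurable_fun setT (Y i) := (neighborhood_sum_sq A X_sq i).1.

Lemma sum_mulrXY :
  \sum_i \int[P]_w (X i w * Y i w) = \int[P]_w (W w ^+ 2).
Proof.
have sq_V i : square_integrable P (fun w => W w - Y i w).
  have <- : outer_sum i = (fun w => W w - Y i w).
    by apply/funext => w; exact: outer_sumE.
  exact: square_integrable_sum.
have XV i := outer_sum_indep (@measurable_id _ R setT)
  (square_integrable1 (sq_V i)).
transitivity (\sum_i \int[P]_w (X i w * W w)).
  apply: eq_bigr => i _.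
  rewrite -[LHS]addr0 -(XV i).2 -RintegralD//; last 2 first.
  - apply: square_integrableM => //; exact: neighborhood_sum_sq.
  - exact: (XV i).1.
  by apply: eq_Rintegral => w _; rewrite -mulrDr addrC subrK.
rewrite -Rintegral_sum//; last first.
  by move=> i; apply: square_integrableM => //; exact: total_sum_sq.
by apply: eq_Rintegral => w _; rewrite -mulr_suml expr2.
Qed.

Lemma stein_identity (f : R -> R) (M : R) : continuous f ->
  (forall x, `|f x| <= M) ->
  \int[P]_w (W w * f (W w)) =
  \sum_i \int[P]_w (X i w * (f (W w) - f (W w - Y i w))).
Proof.
move=> cf fM.
have mf : measurable_fun setT f by exact: continuous_measurable_fun.
have intXf i (V : T -> R) : measurable_fun setT V ->
    P.-integrable setT (EFin \o (fun w => X i w * f (V w))).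
  move=> mV; under eq_fun do rewrite mulrC.
  apply: (le_integrable_mul_bounded _ _ (fun w _ => fM (V w))) => //.
    exact: (measurableT_comp mf mV).
  exact: square_integrable1.
have mV i : measurable_fun setT (fun w => W w - Y i w)
  by exact: measurable_funB.
transitivity (\sum_i \int[P]_w (X i w * f (W w))).
  rewrite -Rintegral_sum//; last by move=> i; exact: intXf.
  by apply: eq_Rintegral => w _; rewrite -mulr_suml.
apply: eq_bigr => i _.
have [|_ V0] := @outer_sum_indep i f mf.
  apply: (probability_bounded_integrable P (M := M)) => //.
  exact: (measurableT_comp mf (mV i)).
rewrite -[LHS]subr0 -[X in _ - X]V0 -RintegralB//; last 2 first.
- exact: intXf.
- exact: (intXf i _ (mV i)).
by apply: eq_Rintegral => w _; rewrite mulrBr.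
Qed.

End local_dependence_identities.

(** * Kolmogorov bound under local dependence *)

Section error_terms.
Context d (T : measurableType d) (R : realType) (P : probability T R).
Context (J : finType) (X : J -> {RV P >-> R}) (A : J -> {set J}).
Local Notation W := (total_sum X).
Hypothesis X_sq : forall i, square_integrable P (X i).

Local Open Scope ereal_scope.

Lemma r1E : r1 X A = (covariance_error X A)%:E.
Proof.
have iXY i : P.-integrable setT
    (EFin \o (fun w => X i w * neighborhood_sum X A i w)%R).
  by apply: square_integrableM => //; exact: neighborhood_sum_sq.
rewrite /r1 expectation_EFin.
  congr EFin; apply: eq_Rintegral => w _; congr `|_|%R.
  by apply: eq_bigr => i _; rewrite fine_expectation.
apply: integrable_normr => //; apply: integrable_sumr => // i.
apply: integrable_subr => //; exact: finite_measure_integrable_cst.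
Qed.

Lemma r2E : r2 X A = (tail_term X A)%:E.
Proof.
rewrite /r2 /tail_term -sumEFin; apply: eq_bigr => i _.
by rewrite expectation_EFin//; exact: integrable_tail_term.
Qed.

Lemma r3E : r3 X A = (kernel_moment X A (fun=> 1%R))%:E.
Proof.
rewrite /r3 /kernel_moment -sumEFin; apply: eq_bigr => i _.
have := integrable_kernel_moment A X_sq i (square_integrable_cst P 1%R).
under eq_fun do rewrite mul1r; move=> int1.
by rewrite expectation_EFin.
Qed.

Lemma r4E : r4 X A = (kernel_moment X A W)%:E.
Proof.
rewrite /r4 /kernel_moment -sumEFin; apply: eq_bigr => i _.
rewrite expectation_EFin//.
exact: (integrable_kernel_moment A X_sq i (total_sum_sq X_sq)).
Qed.

Lemma variance_KhatE t : 'V_P[Khat X A t] = (Khat_var X A t)%:E.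
Proof. by rewrite variance_EFin//; exact: Khat_sq. Qed.

Lemma r5E : r5 X A = (total_var X A)%:E.
Proof.
rewrite /r5; under eq_integral do rewrite variance_KhatE.
apply: Rintegral_EFin; first exact: measurable_window.
exact: integrable_Khat_var.
Qed.

Lemma r6E : r6 X A = (Num.sqrt (weighted_var X A))%:E.
Proof.
rewrite /r6; under eq_integral do rewrite variance_KhatE -EFinM.
rewrite [X in X `^ _](_ : _ = (weighted_var X A)%:E).
  by rewrite poweR_EFin powR12_sqrt// weighted_var_ge0.
apply: Rintegral_EFin; first exact: measurable_window.
exact: integrable_weighted_Khat_var.
Qed.

Lemma cdf_total_sumE z :
  cdf_total_sum X z = (\int[P]_w (W w <= z)%R%:R)%:E.
Proof.
rewrite -Rintegral_EFin//; last exact: integrable_le_bool.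
rewrite /cdf_total_sum /cdf /distribution/= /pushforward.
have mS : measurable (W @^-1` `]-oo, z]%classic).
  rewrite -[_ @^-1` _]setTI; apply: (total_sum_sq X_sq).1 => //.
rewrite -[LHS]mul1e -[LHS]integral_cst// integral_mkcond.
apply: eq_integral => w _; rewrite patchE.
by rewrite [w \in _]asboolb/= in_itv/=; case: (W w <= z)%R.
Qed.

End error_terms.

Local Open Scope ereal_scope.

Theorem theorem2p1 (R : realType) (d : measure_display) (T : measurableType d)
    (P : probability T R) (J : finType) (X : J -> {RV P >-> R})
    (mean0 : forall i, 'E_P[X i] = 0)
    (finite_variance : forall i, 'V_P[X i] < +oo)
    (variance_W : 'V_P[total_sum X] = 1)
    (A : J -> {set J})
    (indep : forall i, independent_of_family X (X i) (~: A i)) :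
  ereal_sup (range (fun z : R => `|cdf_total_sum X z - std_normal_cdf z|))
  <= r1 X A + 4%:E * r2 X A + 8%:E * r3 X A + r4 X A
     + (9 / 2)%:E * r5 X A + (3 / 2)%:E * r6 X A.
Proof.
have X_sq i : square_integrable P (X i) by exact: centered_square_integrable.
have X0 i : (\int[P]_w X i w)%R = 0%R by rewrite -fine_expectation mean0.
have EW2 : (\int[P]_w (total_sum X w ^+ 2) = 1)%R.
  move: variance_W; rewrite variance_EFin; last exact: total_sum_sq.
  rewrite (total_sum_mean0 X_sq X0) => -[<-].
  by apply: eq_Rintegral => w _; rewrite subr0.
have sumXY := sum_mulrXY X_sq X0 indep; rewrite EW2 in sumXY.
have bound := kolmogorov_bound_slack X_sq
  (fun f M => stein_identity X_sq X0 indep (f := f) (M := M)) sumXY EW2.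
rewrite r1E// r2E// r3E// r4E// r5E// r6E//.
apply: ge_ereal_sup => _ [z _ <-].
rewrite cdf_total_sumE// -EFin_gauss_cdf -!EFinM -!EFinD lee_fin.
apply/ler_addgt0Pr => e e0.
have e4 : (0 < e / 4)%R by rewrite divr_gt0.
apply: le_trans (bound z (e / 4)%R e4) _.
by rewrite lerD2l mulrC divfK.
Qed.
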